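(* For every $k\ge 2$, $\Lambda_k\in\mathbb{Z}[\xi]$. More precisely, writing $\Lambda_k=\sum_m c_k(m)\xi^m$ (a finite sum with integer coefficients), one has $$\Lambda_2=3\xi^2-2\xi^3,$$ and for $k\ge 3$, $$\Lambda_k=\sum_{\ell}c_{k-1}(\ell)\,\zeta_{2^{k-3},\ell},$$ where $\zeta_{i,j}=U(\kappa^i\xi^j)$.
   Context: Let $E(q)=\prod_{m\ge1}(1-q^m)$. $PDO(n)$ is the number of partitions of $n$ into odd parts with designated summands (for each distinct part size, exactly one occurrence is designated); its generating function is $\sum_{n\ge0}PDO(n)q^n=\frac{E(q^4)E(q^6)^2}{E(q)E(q^3)E(q^{12})}$. Define $$\gamma(q)=\frac{E(q)^5E(q^2)^5E(q^6)^5}{E(q^3)^{15}},\quad \xi=\xi(q)=\frac{E(q^2)^5E(q^6)}{E(q)E(q^3)^5},\quad \kappa(q)=\frac{\gamma(q^2)^2}{\gamma(q)},$$ and for $k\ge2$, $\Lambda_k=\Lambda_k(q)=\gamma(q)^{2^{k-2}}\sum_{n\ge0}PDO(2^kn)q^n$. $U$ is the operator $U\left(\sum_n a_nq^n\right)=\sum_n a_{2n}q^n$. Membership in $\mathbb{Z}[\xi]$ means equality, as formal power series in $q$, with a polynomial in $\xi$ with integer coefficients. *)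

(* Defs.v *)
(* Formal power series in q with integer coefficients are
   represented by their coefficient sequences  nat -> int. *)
From mathcomp Require Import all_boot all_order all_algebra.
Set Implicit Arguments. Unset Strict Implicit. Unset Printing Implicit Defensive.
Import Order.TTheory GRing.Theory Num.Theory.
Local Open Scope ring_scope.

Definition ps := nat -> int.

Definition ps_one : ps := fun n => if n is 0%N then 1 else 0.
Definition ps_mul (f g : ps) : ps :=
  fun n => \sum_(i < n.+1) f i * g (n - i)%N.
Definition ps_pow (f : ps) (k : nat) : ps := iter k (ps_mul f) ps_one.

(* Inverse of a series with constant term 1:  1/f = sum_j (1 - f)^j,
   the sum being finite coefficientwise since (1 - f) has valuation >= 1. *)
Definition ps_inv (f : ps) : ps :=
  fun n => \sum_(j < n.+1) ps_pow (fun m => ps_one m - f m) j n.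

Definition ps_dil (a : nat) (f : ps) : ps :=
  fun n => if (a %| n)%N then f (n %/ a)%N else 0.

Definition U (f : ps) : ps := fun n => f (2 * n)%N.

(* E(q) = prod_{m>=1} (1 - q^m); its n-th coefficient is that of the finite
   product over 1 <= m <= n. *)
Definition E : ps :=
  fun n => (\prod_(1 <= m < n.+1) (1 - 'X^m) : {poly int})`_n.

Definition gamma : ps :=
  ps_mul (ps_mul (ps_mul (ps_pow E 5) (ps_pow (ps_dil 2 E) 5))
                 (ps_pow (ps_dil 6 E) 5))
         (ps_inv (ps_pow (ps_dil 3 E) 15)).

Definition xi : ps :=
  ps_mul (ps_mul (ps_pow (ps_dil 2 E) 5) (ps_dil 6 E))
         (ps_inv (ps_mul E (ps_pow (ps_dil 3 E) 5))).

Definition kappa : ps := ps_mul (ps_pow (ps_dil 2 gamma) 2) (ps_inv gamma).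

(* PDO(n): partitions of n into odd parts with designated summands.
   A partition of n is encoded by its multiplicity function m (m i = number
   of parts equal to i, all parts/multiplicities are <= n); the number of
   ways to designate one occurrence of each distinct part is prod_{m i>0} m i. *)
Definition PDO (n : nat) : nat :=
  (\sum_(m : {ffun 'I_n.+1 -> 'I_n.+1} |
          ((\sum_(i < n.+1) i * m i)%N == n) && [forall i, (0 < m i)%N ==> odd i])
     \prod_(i < n.+1 | (0 < m i)%N) m i)%N.

Definition Lambda (k : nat) : ps :=
  ps_mul (ps_pow gamma (2 ^ (k - 2))) (fun n => (PDO (2 ^ k * n))%:Z).

Definition ps_peval (P : {poly int}) (x : ps) : ps :=
  fun n => \sum_(i < size P) P`_i * ps_pow x i n.

Definition zeta (i j : nat) : ps := U (ps_mul (ps_pow kappa i) (ps_pow xi j)).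

(* Main.v *)
(* Write E_a = E(q^a), X = xi(q^2), r = kappa^(1/5), s(q) = r(-q).  Everything rests on the
   2-dissection
     E_3^3/E_1 = E_4^3 E_6^2/(E_2^2 E_12) + q E_12^3/E_4.
   The left side is the bilateral Lambert series sum_n q^n/(1 - q^(3n+1)), a limit of partial
   fractions, so its n-th coefficient is f(3n+1) with f(N) = sum_{d | N} (d/3); its even part is
   the analogous Lambert series of modulus 6, and its odd part follows from f(4M) = f(M) and
   f(2M) = 0 for M odd.
   The dissection gives U(r) = xi, r + s = 2X and r s = X; multiplied by its image under
   q -> -q it gives xi - 1 = q E_1^3 E_6^9/(E_2^3 E_3^9), and together they yield
   xi = 3s - 2s^2.  Since s^2 = 2Xs - X, the products kappa^i xi^j lie in Z[X] + Z[X] s, which U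
   maps to Z[xi].
   For Lambda_2, taking square roots in these identities gives the even part of 1/(E_1 E_3),
   hence U of the generating function of PDO, and
   gamma(q^2) U(sum PDO(n) q^n) = X^2 (3 - 2s). *)
Require Import Defs.
From HB Require Import structures.
From mathcomp Require Import all_boot all_order all_algebra.
From mathcomp Require Import boolp zify ring.
Import Order.TTheory GRing.Theory Num.Theory.
Local Open Scope ring_scope.

Set Implicit Arguments. Unset Strict Implicit. Unset Printing Implicit Defensive.

(** * The ring of integer power series *)

(** To become bilateral, the partial fractions must have their poles shifted by a negative power of
    q, and such powers exist only in the fraction field of [ps]. So the finite identity is proved
    over a field and pulled back to series, and only then is the limit taken, modulo powers of q.
    Relations between quotients of the E_a are checked in the same fraction field. The relations
    satisfied by s turn certain linear forms in s into products: 2s - 1 = s^2/X, 3 - 2s = xi/s and,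
    by comparison of squares, 4s - 3 = E_1^4 E_6^2/(E_2^2 E_3^4). This is what makes the square
    roots available: for V = 1/(E_1 E_3), V^2 is 3 - 2s times a series in q^2, and (V(q) + V(-q))^2
    turns out to be the square of an explicit product. In an integral domain a square root is known
    up to sign, and the constant term settles the sign. *)

HB.instance Definition _ := gen_eqMixin ps.
HB.instance Definition _ := gen_choiceMixin ps.

Definition ps_zero : ps := fun=> 0.
Definition ps_opp (f : ps) : ps := fun n => - f n.
Definition ps_add (f g : ps) : ps := fun n => f n + g n.

Fact ps_addA : associative ps_add.
Proof. by move=> f g h; apply: funext => n; exact: addrA. Qed.
Fact ps_addC : commutative ps_add.
Proof. by move=> f g; apply: funext => n; exact: addrC. Qed.
Fact ps_add0 : left_id ps_zero ps_add.
Proof. by move=> f; apply: funext => n; exact: add0r. Qed.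
Fact ps_addN : left_inverse ps_zero ps_opp ps_add.
Proof. by move=> f; apply: funext => n; exact: addNr. Qed.

HB.instance Definition _ := GRing.isZmodule.Build ps ps_addA ps_addC ps_add0 ps_addN.

Definition trunc (N : nat) (f : ps) : {poly int} := \poly_(i < N) f i.

(** A coefficient of a product involves finitely many coefficients of the factors, so commutativity
    and associativity are inherited from polynomials through truncation. *)
Lemma ps_mul_trunc N f g n : (n < N)%N ->
  ps_mul f g n = (trunc N f * trunc N g)`_n.
Proof.
move=> lt_nN; rewrite coefM; apply: eq_bigr => -[i /= lt_in] _.
by rewrite !coef_poly !ifT //; lia.
Qed.

Fact ps_mulC : commutative ps_mul.
Proof.
by move=> f g; apply: funext => n; rewrite !(ps_mul_trunc _ _ (ltnSn n)) mulrC.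
Qed.

Fact ps_mulA : associative ps_mul.
Proof.
move=> f g h; apply: funext => n.
transitivity ((trunc n.+1 f * (trunc n.+1 g * trunc n.+1 h))`_n).
  rewrite coefM; apply: eq_bigr => -[i /= lt_in] _.
  by rewrite coef_poly lt_in (@ps_mul_trunc n.+1) // ltnS leq_subr.
rewrite mulrA coefM; apply: eq_bigr => -[i /= lt_in] _.
by rewrite (ps_mul_trunc _ _ lt_in) coef_poly ltnS leq_subr.
Qed.

Fact ps_mul1 : left_id ps_one ps_mul.
Proof.
move=> f; apply: funext => n; rewrite /ps_mul big_ord_recl /= subn0 mul1r.
by rewrite big1 ?addr0 // => i _; rewrite mul0r.
Qed.

Fact ps_mulD : left_distributive ps_mul ps_add.
Proof.
move=> f g h; apply: funext => n; rewrite /ps_mul /ps_add -big_split /=.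
by apply: eq_bigr => i _; rewrite mulrDl.
Qed.

Fact ps_one_neq0 : ps_one != 0 :> ps.
Proof. by apply/eqP => /(congr1 (fun f : ps => f 0%N)). Qed.

HB.instance Definition _ := GRing.Zmodule_isComNzRing.Build ps
  ps_mulA ps_mulC ps_mul1 ps_mulD ps_one_neq0.

(** Inverses are picked by classical choice, which gives a total [^-1]; [ps_invE] identifies it with
    the explicit [ps_inv] when the constant term is 1. *)
Definition ps_is_unit : {pred ps} := fun f => `[< exists g, ps_mul g f = ps_one >].
Definition ps_invr (f : ps) : ps :=
  if pselect (exists g, ps_mul g f = ps_one) is left ex then projT1 (cid ex) else f.

Fact ps_mulVr : {in ps_is_unit, left_inverse 1 ps_invr *%R}.
Proof.
move=> f /asboolP ex; rewrite /ps_invr; case: pselect => // ex'.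
by case: (cid ex').
Qed.
Fact ps_unitP (f g : ps) : g * f = 1 -> ps_is_unit f.
Proof. by move=> gf; apply/asboolP; exists g. Qed.
Fact ps_invr_out : {in [predC ps_is_unit], ps_invr =1 id}.
Proof. by move=> f /asboolPn nex; rewrite /ps_invr; case: pselect. Qed.

HB.instance Definition _ := GRing.ComNzRing_hasMulInverse.Build ps
  ps_mulVr ps_unitP ps_invr_out.

Lemma psE0 n : (0 : ps) n = 0. Proof. by []. Qed.
Lemma psE1 n : (1 : ps) n = (n == 0)%:R. Proof. by case: n. Qed.
Lemma psED (f g : ps) n : (f + g) n = f n + g n. Proof. by []. Qed.
Lemma psEN (f : ps) n : (- f) n = - f n. Proof. by []. Qed.
Lemma psEB (f g : ps) n : (f - g) n = f n - g n. Proof. by []. Qed.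
Lemma psEM (f g : ps) n : (f * g) n = \sum_(i < n.+1) f i * g (n - i)%N.
Proof. by []. Qed.
Lemma psE_sum I (s : seq I) (P : pred I) (F : I -> ps) n :
  (\sum_(i <- s | P i) F i) n = \sum_(i <- s | P i) F i n.
Proof. by elim/big_rec2: _ => // i x y _ <-. Qed.
Lemma psEMn (f : ps) k n : (f *+ k) n = f n *+ k.
Proof. by elim: k => // k IH; rewrite !mulrSr psED IH. Qed.
Lemma psEnat (k : nat) n : (k%:R : ps) n = if n == 0%N then k%:R else 0.
Proof. by rewrite psEMn psE1; case: n => //=; rewrite mul0rn. Qed.
Lemma psEM0 (f g : ps) : (f * g) 0%N = f 0%N * g 0%N.
Proof. by rewrite psEM big_ord1. Qed.

(** If the lowest nonzero terms sit at degrees a and b, the coefficient of q^(a+b) in the product is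
    the product of these two coefficients. *)
Fact ps_mulf_eq0 (f g : ps) : f * g = 0 -> (f == 0) || (g == 0).
Proof.
move=> fg0; apply: contra_eqT fg0; rewrite negb_or => /andP[f0 g0].
have low (h : ps) : h != 0 -> exists n, h n != 0 /\ forall m, (m < n)%N -> h m = 0.
  move=> h0; have ex : exists n, h n != 0.
    apply: contrapT => nex; move/eqP: h0; apply; apply: funext => n.
    by apply/eqP; apply: contrapT => /negP hn; apply: nex; exists n.
  case: (ex_minnP ex) => n hn min; exists n; split=> // m lt_mn; apply/eqP.
  by apply: contraTT lt_mn => /min; rewrite -leqNgt.
have [a [fa fl]] := low _ f0; have [b [gb gl]] := low _ g0.
apply/eqP => /(congr1 (fun h : ps => h (a + b)%N)) /eqP.
rewrite psE0 psEM; have lt_a : (a < (a + b).+1)%N by lia.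
rewrite (bigD1 (Ordinal lt_a)) //= big1 ?addr0 => [|i /eqP ia].
  by rewrite addKn mulf_eq0 (negPf fa) (negPf gb).
have [lt_ia|le_ai] := ltnP i a; first by rewrite fl // mul0r.
rewrite [g _]gl ?mulr0 //; have : (i : nat) <> a by move=> e; apply: ia; apply: val_inj.
by have := ltn_ord i; lia.
Qed.

HB.instance Definition _ := GRing.ComUnitRing_isIntegral.Build ps ps_mulf_eq0.

Lemma ps_powE (f : ps) k : ps_pow f k = f ^+ k.
Proof. by elim: k => // k IH; rewrite exprS -IH. Qed.

(** * Congruence modulo powers of q *)

(** Congruence modulo q^N; every limit below is taken through it. *)
Definition eqm (N : nat) (f g : ps) := forall n, (n < N)%N -> f n = g n.

Lemma eqm_refl N f : eqm N f f. Proof. by []. Qed.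
Lemma eqm_sym N f g : eqm N f g -> eqm N g f.
Proof. by move=> e n /e. Qed.
Lemma eqm_trans N f g h : eqm N f g -> eqm N g h -> eqm N f h.
Proof. by move=> e1 e2 n lt_n; rewrite e1 ?e2. Qed.
Lemma eqm_le N M f g : (M <= N)%N -> eqm N f g -> eqm M f g.
Proof. by move=> le_MN e n lt_n; apply: e; apply: leq_trans le_MN. Qed.
Lemma eqmD N f g f' g' : eqm N f f' -> eqm N g g' -> eqm N (f + g) (f' + g').
Proof. by move=> e1 e2 n lt_n; rewrite !psED e1 ?e2. Qed.
Lemma eqmN N f f' : eqm N f f' -> eqm N (- f) (- f').
Proof. by move=> e n lt_n; rewrite !psEN e. Qed.
Lemma eqmM N f g f' g' : eqm N f f' -> eqm N g g' -> eqm N (f * g) (f' * g').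
Proof.
move=> e1 e2 n lt_n; rewrite !psEM; apply: eq_bigr => i _.
by rewrite e1 ?e2 //; have := ltn_ord i; lia.
Qed.
Lemma eqm_sum N I (s : seq I) (P : pred I) (F G : I -> ps) :
  (forall i, P i -> eqm N (F i) (G i)) ->
  eqm N (\sum_(i <- s | P i) F i) (\sum_(i <- s | P i) G i).
Proof.
by move=> e; elim/big_rec2: _ => // i x y Pi; apply: eqmD; apply: e.
Qed.
Lemma eqm_prod N I (s : seq I) (P : pred I) (F G : I -> ps) :
  (forall i, P i -> eqm N (F i) (G i)) ->
  eqm N (\prod_(i <- s | P i) F i) (\prod_(i <- s | P i) G i).
Proof.
by move=> e; elim/big_rec2: _ => // i x y Pi; apply: eqmM; apply: e.
Qed.
Lemma eqm_eq f g : (forall N, exists2 M, (N <= M)%N & eqm M f g) -> f = g.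
Proof.
by move=> e; apply: funext => n; have [M lt_nM ->] := e n.+1.
Qed.

(** Geometric series in g = 1 - f: g has no constant term, so g^j vanishes below degree j. Modulo
    q^N, the sum in [ps_inv], whose length varies with the coefficient, thus agrees with the sum of
    the first N powers. *)
Lemma ps_mul_inv (f : ps) : f 0%N = 1 -> f * ps_inv f = 1.
Proof.
move=> f0; pose g : ps := 1 - f.
have pow_low j n : (n < j)%N -> (g ^+ j) n = 0.
  elim: j n => // j IH n lt_nj; rewrite exprS psEM big1 // => -[[|i] /= lt_i] _.
    by rewrite /g psEB f0 mul0r.
  by rewrite IH ?mulr0 //; lia.
have invE N : eqm N (ps_inv f) (\sum_(j < N) g ^+ j).
  move=> n lt_nN; rewrite psE_sum /ps_inv (bigID (fun j : 'I_N => (j < n.+1)%N)) /=.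
  rewrite [X in _ + X]big1 => [|j]; last by rewrite -leqNgt => /pow_low.
  by rewrite addr0 (big_ord_narrow (F := fun j => (g ^+ j) n) lt_nN) /=;
     apply: eq_bigr => j _; rewrite ps_powE.
apply: eqm_eq => N; exists N => //.
apply: eqm_trans (eqmM (eqm_refl f) (invE N)) _.
have -> : f = 1 - g by rewrite /g subKr.
rewrite -[X in (X - g) * _](expr1n _ N) => n lt_n.
have -> : (1 ^+ N - g) * (\sum_(j < N) g ^+ j) = 1 - g ^+ N.
  rewrite -opprB -[in RHS]opprB expr1n mulNr; congr (- _).
  by rewrite subrX1.
by rewrite psEB pow_low // subr0.
Qed.

Lemma ps_unit (f : ps) : f 0%N = 1 -> f \is a GRing.unit.
Proof. by move=> /ps_mul_inv; rewrite mulrC => /ps_unitP. Qed.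

Lemma ps_invE (f : ps) : f 0%N = 1 -> ps_inv f = f^-1.
Proof.
by move=> f0; apply: (mulrI (ps_unit f0)); rewrite ps_mul_inv // divrr ?ps_unit.
Qed.

Lemma eqm_cancel N (f g h : ps) : f 0%N = 1 -> eqm N (f * g) (f * h) -> eqm N g h.
Proof.
move=> f0 e; have := eqmM (eqm_refl (N := N) f^-1) e.
by rewrite !mulKr ?ps_unit.
Qed.

Lemma eqmV N (f g : ps) : f 0%N = 1 -> g 0%N = 1 -> eqm N f g -> eqm N f^-1 g^-1.
Proof.
move=> f0 g0 e; apply: (@eqm_cancel _ (f * g)); first by rewrite psEM0 f0 g0.
by rewrite mulrAC divrr ?mulrK ?mul1r ?ps_unit //; apply: eqm_sym.
Qed.

(** * Dilation, change of sign of q, and the operator U *)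

Lemma dil_is_zmod a : zmod_morphism (ps_dil a).
Proof.
move=> f g; apply: funext => n; rewrite psEB /ps_dil.
by case: ifP; rewrite ?subr0.
Qed.
HB.instance Definition _ a := GRing.isZmodMorphism.Build ps ps (ps_dil a) (dil_is_zmod a).

Lemma dilE a f n : (0 < a)%N -> ps_dil a f (a * n)%N = f n.
Proof. by move=> a0; rewrite /ps_dil dvdn_mulr // mulKn. Qed.

Lemma dilE0 a f : ps_dil a f 0%N = f 0%N.
Proof. by rewrite /ps_dil dvdn0 div0n. Qed.

Lemma dil1 a : ps_dil a 1 = 1.
Proof.
apply: funext => n; rewrite /ps_dil !psE1; case: ifP => [/dvdnP[k ->]|].
  case: a => [|a]; first by rewrite muln0 divn0.
  by rewrite mulnK // muln_eq0 orbF.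
by case: n => //; rewrite dvdn0.
Qed.

Lemma big_block (R : Type) (idx : R) (op : Monoid.law idx) (k n : nat) (F : nat -> R) :
  \big[op/idx]_(i < n * k) F i =
  \big[op/idx]_(j < n) \big[op/idx]_(i < k) F (j * k + i)%N.
Proof.
rewrite -(big_mkord xpredT F) big_nat_mul big_mkord; apply: eq_bigr => j _.
rewrite -{1}[(j * k)%N]add0n mulSn big_addn addnK big_mkord.
by apply: eq_bigr => i _; rewrite addnC.
Qed.

Lemma sum_multiples a n (F : nat -> int) :
  (forall i, ~~ (a.+1 %| i)%N -> F i = 0) ->
  \sum_(i < (a.+1 * n).+1) F i = \sum_(j < n.+1) F (a.+1 * j)%N.
Proof.
move=> F0; rewrite [LHS]big_ord_recr [RHS]big_ord_recr /=; congr (_ + _).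
rewrite mulnC big_block; apply: eq_bigr => j _.
rewrite big_ord_recl /= addn0 mulnC big1 ?addr0 // => i _; apply: F0.
rewrite dvdn_addr ?dvdn_mulr // gtnNdvd // /bump /= add1n //.
by have := ltn_ord i.
Qed.

(** Positivity is built into [a.+1], so the morphism instance applies to numerals such as [ps_dil 2]
    without a side condition. *)
Lemma dil_is_monoid a : monoid_morphism (ps_dil a.+1).
Proof.
split=> [|f g]; first exact: dil1.
apply: funext => n; rewrite psEM {1}/ps_dil; case: ifP => [/dvdnP[m ->]|dvF].
  rewrite mulnK // psEM mulnC.
  rewrite (@sum_multiples a m (fun i => ps_dil a.+1 f i * ps_dil a.+1 g (a.+1 * m - i)%N)).
    by apply: eq_bigr => j _; rewrite -mulnBr !dilE.
  by move=> i /negPf dvF; rewrite /ps_dil dvF mul0r.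
rewrite big1 // => i _; rewrite /ps_dil; case: ifP => [dvi|]; last by rewrite mul0r.
by rewrite dvdn_subl ?dvF ?mulr0 //; have := ltn_ord i; rewrite ltnS.
Qed.
HB.instance Definition _ a :=
  GRing.isMonoidMorphism.Build ps ps (ps_dil a.+1) (dil_is_monoid a).

Lemma dil_dil a b f : (0 < a)%N -> (0 < b)%N -> ps_dil a (ps_dil b f) = ps_dil (a * b) f.
Proof.
move=> a0 b0; apply: funext => n; rewrite /ps_dil.
have [/dvdnP[m ->]|dvF] := boolP (a %| n)%N.
  by rewrite mulnK // [(m * a)%N]mulnC dvdn_pmul2l // divnMl.
by rewrite ifF //; apply: contraNF dvF; apply: dvdn_trans; rewrite dvdn_mulr.
Qed.

Lemma dil_inj a : (0 < a)%N -> injective (ps_dil a).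
Proof.
move=> a0 f g e; apply: funext => n.
by rewrite -[LHS](dilE f n a0) e dilE.
Qed.

Definition sgn (f : ps) : ps := fun n => (-1) ^+ n * f n.

Lemma sgn_is_zmod : zmod_morphism sgn.
Proof. by move=> f g; apply: funext => n; rewrite psEB /sgn psEB mulrBr. Qed.
HB.instance Definition _ := GRing.isZmodMorphism.Build ps ps sgn sgn_is_zmod.

Lemma sgn_is_monoid : monoid_morphism sgn.
Proof.
split=> [|f g]; apply: funext => n; first by case: n => [|n]; rewrite /sgn psE1 ?mulr0 ?mul1r.
rewrite /sgn !psEM mulr_sumr; apply: eq_bigr => -[i /= lt_in] _.
have -> : (-1) ^+ n = (-1) ^+ i * (-1) ^+ (n - i) :> int by rewrite -exprD subnKC.
by ring.
Qed.
HB.instance Definition _ := GRing.isMonoidMorphism.Build ps ps sgn sgn_is_monoid.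

Lemma sgnK : involutive sgn.
Proof. by move=> f; apply: funext => n; rewrite /sgn mulrA -expr2 sqrr_sign mul1r. Qed.

Lemma sgnE0 f : sgn f 0%N = f 0%N. Proof. by rewrite /sgn mul1r. Qed.

Lemma sgn_dil_odd a f : odd a -> sgn (ps_dil a f) = ps_dil a (sgn f).
Proof.
move=> a1; apply: funext => n; rewrite /sgn /ps_dil.
case: ifP => [/dvdnP[m ->]|]; last by rewrite mulr0.
by rewrite mulnK ?odd_gt0 // -signr_odd oddM a1 andbT signr_odd.
Qed.

Lemma sgn_dil_even a f : ~~ odd a -> sgn (ps_dil a f) = ps_dil a f.
Proof.
move=> /negPf a1; apply: funext => n; rewrite /sgn /ps_dil.
case: ifP => [/dvdnP[m ->]|]; last by rewrite mulr0.
by rewrite -signr_odd oddM a1 andbF mul1r.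
Qed.

Lemma U_is_zmod : zmod_morphism U.
Proof. by move=> f g; apply: funext. Qed.
HB.instance Definition _ := GRing.isZmodMorphism.Build ps ps U U_is_zmod.

(** Both sides are twice the even part of f; keeping the factor 2 avoids halves, and [mulrn_inj]
    removes it later. *)
Lemma dil2_U f : ps_dil 2 (U f) *+ 2 = f + sgn f.
Proof.
apply: funext => n; rewrite psEMn psED /sgn /ps_dil -signr_odd.
have [/dvdnP[m ->]|] := boolP (2 %| n)%N.
  by rewrite mulnK // oddM andbF expr0 mul1r mulr2n /U mulnC.
by rewrite dvdn2 negbK => ->; rewrite expr1 mulN1r subrr.
Qed.

Lemma mulrn_inj (f g : ps) k : (0 < k)%N -> f *+ k = g *+ k -> f = g.
Proof.
move=> k0 e; apply: funext => n; apply: (pmulrnI k0).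
by have := congr1 (fun h : ps => h n) e; rewrite !psEMn.
Qed.

(** Series in q^2 are fixed by [sgn], so [U] is linear over them. Later computations of [U] split
    off a factor of this kind. *)
Lemma UM_dil f g : U (f * ps_dil 2 g) = U f * g.
Proof.
apply: (@dil_inj 2) => //; apply: (@mulrn_inj _ _ 2) => //.
by rewrite dil2_U !rmorphM /= sgn_dil_even // -mulrDl -dil2_U mulrnAl.
Qed.

Lemma U_dil g : U (ps_dil 2 g) = g.
Proof. by apply: funext => n; rewrite /U dilE. Qed.

Lemma U_even f g : f + sgn f = ps_dil 2 g *+ 2 -> U f = g.
Proof. by rewrite -dil2_U => /mulrn_inj e; apply: (@dil_inj 2) => //; apply: e. Qed.

(** In an integral domain f = g or f = -g, and the constant term of f + g excludes the second. *)
Lemma ps_sqr_inj (f g : ps) : (f + g) 0%N != 0 -> f ^+ 2 = g ^+ 2 -> f = g.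
Proof.
move=> fg0 /eqP; rewrite eqf_sqr => /orP[/eqP //|/eqP fg].
by rewrite fg addNr psE0 eqxx in fg0.
Qed.

(** * Infinite products *)

Definition of_poly (p : {poly int}) : ps := fun n => p`_n.

Lemma of_poly_is_zmod : zmod_morphism of_poly.
Proof. by move=> p r; apply: funext => n; rewrite psEB /of_poly coefB. Qed.
HB.instance Definition _ := GRing.isZmodMorphism.Build {poly int} ps of_poly of_poly_is_zmod.

Lemma of_poly_is_monoid : monoid_morphism of_poly.
Proof.
split=> [|p r]; apply: funext => n; first by rewrite psE1 /of_poly coef1.
by rewrite psEM /of_poly coefM.
Qed.
HB.instance Definition _ := GRing.isMonoidMorphism.Build {poly int} ps of_poly of_poly_is_monoid.

Definition q : ps := of_poly 'X.

Lemma qXE k n : (q ^+ k) n = (n == k)%:R.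
Proof. by rewrite -rmorphXn /= /of_poly coefXn. Qed.

Lemma qXME k f n : (q ^+ k * f) n = if (k <= n)%N then f (n - k)%N else 0.
Proof.
rewrite psEM; case: leqP => [le_kn|lt_nk].
  rewrite (bigD1 (Ordinal (le_kn : (k < n.+1)%N))) //= qXE eqxx mul1r big1 ?addr0 // => i ik.
  rewrite qXE (_ : (i == k :> nat) = false) ?mul0r //.
  by apply: contraNF ik => /eqP e; apply/eqP/val_inj.
rewrite big1 // => i _; rewrite qXE (_ : (i == k :> nat) = false) ?mul0r //.
by apply/negbTE; have := ltn_ord i; lia.
Qed.

Lemma qXM_eqm0 k N f : (N <= k)%N -> eqm N (q ^+ k * f) 0.
Proof. by move=> le_Nk n lt_nN; rewrite qXME leqNgt (leq_trans lt_nN le_Nk). Qed.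

Lemma dil_q a : (0 < a)%N -> ps_dil a q = q ^+ a.
Proof.
move=> a0; apply: funext => n; rewrite qXE /ps_dil /q /of_poly.
case: ifP => [/dvdnP[m ->]|dvF].
  by rewrite mulnK // coefX -{2}[a]mul1n eqn_pmul2r.
by case: eqP dvF => // ->; rewrite dvdnn.
Qed.

Lemma sgn_q : sgn q = - q.
Proof.
apply: funext => n; rewrite psEN /sgn /q /of_poly coefX.
by case: n => [|[|n]]; rewrite ?mulr0 ?oppr0 ?expr1 ?mulN1r.
Qed.

(** Factor m differs from 1 only beyond q^m, so coefficient n of the infinite product is settled by
    the factors of index below n. *)
Definition near1 (F : nat -> ps) := forall m, eqm m.+1 (F m) 1.

Definition prodinf (F : nat -> ps) : ps := fun n => (\prod_(m < n.+1) F m) n.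

Lemma prod_stable F N M : near1 F -> (N <= M)%N ->
  eqm N.+1 (\prod_(m < M) F m) (\prod_(m < N) F m).
Proof.
move=> F1; elim: M => [|M IH]; first by rewrite leqn0 => /eqP ->.
rewrite leq_eqVlt => /orP[/eqP -> //|]; rewrite ltnS => le_NM.
rewrite big_ord_recr /= -[X in eqm _ _ X]mulr1; apply: eqmM; first exact: IH.
exact: eqm_le (F1 M).
Qed.

Lemma prodinfE F N : near1 F -> eqm N.+1 (prodinf F) (\prod_(m < N) F m).
Proof.
move=> F1 n; rewrite ltnS => le_nN; rewrite /prodinf.
rewrite (prod_stable F1 (leqnSn n)) //; apply/esym.
exact: (prod_stable F1 le_nN).
Qed.

Lemma prodinf_uniq F f : near1 F -> (forall N, exists2 M, (N <= M)%N &
  eqm N f (\prod_(m < M) F m)) -> f = prodinf F.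
Proof.
move=> F1 fF; apply: eqm_eq => N; exists N => //; have [M le_NM fM] := fF N.
apply: eqm_trans fM _; apply: eqm_sym; apply: eqm_le (prodinfE F1); lia.
Qed.

Lemma prodinfM F G : near1 F -> near1 G ->
  prodinf F * prodinf G = prodinf (fun m => F m * G m).
Proof.
move=> F1 G1; apply: prodinf_uniq => [m|N].
  by rewrite -[1]mulr1; apply: eqmM.
exists N => //; rewrite big_split /=.
by apply: eqmM; apply: eqm_le (prodinfE _).
Qed.

Lemma near1_prod (I : Type) (s : seq I) (F : I -> nat -> ps) :
  (forall i, near1 (F i)) -> near1 (fun m => \prod_(i <- s) F i m).
Proof.
move=> F1 m; have e : \prod_(i <- s) 1 = 1 :> ps by rewrite big1.
by rewrite -[X in eqm _ _ X]e; apply: eqm_prod => i _; apply: F1.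
Qed.

Lemma prodinf_prod (I : Type) (s : seq I) (F : I -> nat -> ps) :
  (forall i, near1 (F i)) ->
  \prod_(i <- s) prodinf (F i) = prodinf (fun m => \prod_(i <- s) F i m).
Proof.
move=> F1; elim: s => [|i s IH].
  rewrite big_nil; apply: prodinf_uniq => [m|N]; first by rewrite big_nil.
  by exists N => //; rewrite big1 // => j _; rewrite big_nil.
rewrite big_cons IH prodinfM //; last exact: near1_prod.
by congr prodinf; apply: funext => m; rewrite big_cons.
Qed.

Lemma prodinf_block F k : (0 < k)%N -> near1 F ->
  prodinf F = \prod_(j < k) prodinf (fun m => F (m * k + j)%N).
Proof.
move=> k0 F1; have Fj1 j : near1 (fun m => F (m * k + j)%N).
  by move=> m; apply: eqm_le (F1 _); rewrite ltnS (leq_trans (leq_pmulr m k0)) ?leq_addr.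
rewrite prodinf_prod //; apply: prodinf_uniq => [|N]; first exact: near1_prod.
exists N => //; rewrite -(big_block _ k N F).
by apply: eqm_le (prodinfE F1); rewrite (leq_trans (leq_pmulr N k0)).
Qed.

(** The first hypothesis is q-adic continuity of [h], which carries the finite products to the
    limit. *)
Lemma rmorph_prodinf (h : {rmorphism ps -> ps}) F :
  (forall N f g, eqm N f g -> eqm N (h f) (h g)) -> near1 F ->
  h (prodinf F) = prodinf (fun m => h (F m)).
Proof.
move=> hN F1; apply: prodinf_uniq => [m|N].
  by rewrite -(rmorph1 h); apply: hN; apply: F1.
exists N => //; rewrite -rmorph_prod; apply: hN.
by apply: eqm_le (prodinfE F1).
Qed.

Lemma dil_eqm a N f g : (0 < a)%N -> eqm N f g -> eqm N (ps_dil a f) (ps_dil a g).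
Proof.
by move=> a0 fg n lt_nN; rewrite /ps_dil fg // (leq_ltn_trans (leq_div n a)).
Qed.

Lemma sgn_eqm N f g : eqm N f g -> eqm N (sgn f) (sgn g).
Proof. by move=> fg n lt_nN; rewrite /sgn fg. Qed.

Lemma near1_sub k F : (forall m, (m < k m)%N) -> near1 (fun m => 1 - q ^+ k m * F m).
Proof.
move=> km m; rewrite -[X in eqm _ _ X]subr0; apply: eqmD => //; apply: eqmN.
exact: qXM_eqm0.
Qed.

(* [poch a k] is the infinite product (q^a; q^k). *)
Definition poch a k := prodinf (fun m => 1 - q ^+ (a + k * m)).

Lemma near1_poch a k : (0 < a)%N -> (0 < k)%N -> near1 (fun m => 1 - q ^+ (a + k * m)).
Proof.
move=> a0 k0 m; rewrite -[q ^+ _]mulr1; apply: (@near1_sub (fun m => a + k * m)%N (fun=> 1)).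
by move=> {}m; case: a k a0 k0 => // a [//|k] _ _; nia.
Qed.

Lemma poch_block a k c : (0 < a)%N -> (0 < k)%N -> (0 < c)%N ->
  poch a k = \prod_(j < c) poch (a + k * j) (k * c).
Proof.
move=> a0 k0 c0; rewrite /poch (prodinf_block c0 (near1_poch a0 k0)).
by apply: eq_bigr => j _; congr prodinf; apply: funext => m; congr (1 - q ^+ _); lia.
Qed.

Lemma dil_poch a k c : (0 < a)%N -> (0 < k)%N -> (0 < c)%N ->
  ps_dil c (poch a k) = poch (c * a) (c * k).
Proof.
move=> a0 k0; case: c => // c _; rewrite /poch rmorph_prodinf.
- congr prodinf; apply: funext => m.
  by rewrite rmorphB rmorph1 rmorphXn /= dil_q // -exprM; congr (1 - q ^+ _); lia.
- by move=> N f g; apply: dil_eqm.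
- exact: near1_poch.
Qed.

Lemma poch0 a k : (0 < a)%N -> (0 < k)%N -> poch a k 0%N = 1.
Proof. by move=> a0 k0; rewrite /poch (@prodinfE _ 0) ?big_ord0 //; apply: near1_poch. Qed.

Lemma E_poch : E = poch 1 1.
Proof.
apply: prodinf_uniq => [|N]; first exact: near1_poch.
exists N => // n lt_nN; transitivity ((\prod_(m < n) (1 - q ^+ (1 + 1 * m))) n).
  rewrite /E (big_addn 0 n.+1 1) subn1 big_mkord.
  rewrite -[LHS]/(of_poly _ n) rmorph_prod; congr ((_ : ps) n); apply: eq_bigr => i _ /=.
  by rewrite rmorphB rmorph1 rmorphXn /= mul1n addnC.
have P1 : near1 (fun m => 1 - q ^+ (1 + 1 * m)) by exact: near1_poch.
by apply/esym/(prod_stable P1 (ltnW lt_nN)).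
Qed.

Lemma E0 : E 0%N = 1. Proof. by rewrite E_poch poch0. Qed.

Lemma dilE_poch k : (0 < k)%N -> ps_dil k E = poch k k.
Proof. by move=> k0; rewrite E_poch dil_poch // muln1. Qed.

Lemma E_odd : E = poch 1 2 * ps_dil 2 E.
Proof. by rewrite dilE_poch // E_poch (@poch_block 1 1 2) // !big_ord_recl big_ord0 mulr1. Qed.

Lemma sgn_poch12 : sgn (poch 1 2) * poch 1 2 = ps_dil 2 (poch 1 2).
Proof.
have P1 : near1 (fun m => 1 - q ^+ (1 + 2 * m)) by exact: near1_poch.
have sgnP1 : near1 (fun m => sgn (1 - q ^+ (1 + 2 * m))).
  by move=> m; rewrite -[X in eqm _ _ X](rmorph1 sgn); apply: sgn_eqm (P1 m).
rewrite dil_poch // {1}/poch rmorph_prodinf //; last exact: sgn_eqm.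
rewrite /poch prodinfM //; congr prodinf; apply: funext => m.
rewrite rmorphB rmorph1 rmorphXn /= sgn_q exprNn -signr_odd oddD oddM /= expr1.
have -> : (2 * 1 + 2 * 2 * m = (1 + 2 * m) * 2)%N by lia.
by rewrite exprM; ring.
Qed.

(** The classical E(-q) = E_2^3/(E_1 E_4), cross-multiplied. It comes from (-q; q^2) (q; q^2) =
    (q^2; q^4) and lets [sgn] act on quotients of the E_a. *)
Lemma sgn_E : sgn E * E * ps_dil 4 E = ps_dil 2 E ^+ 3.
Proof.
have -> : sgn E = sgn (poch 1 2) * ps_dil 2 E.
  by rewrite {1}E_odd rmorphM /= sgn_dil_even.
have e : ps_dil 2 (poch 1 2) * ps_dil 4 E = ps_dil 2 E.
  by rewrite {2}E_odd rmorphM /= dil_dil.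
transitivity (sgn (poch 1 2) * poch 1 2 * ps_dil 4 E * ps_dil 2 E ^+ 2).
  by rewrite [X in _ * X * ps_dil 4 _]E_odd; ring.
by rewrite sgn_poch12 e; ring.
Qed.

(** * A bilateral Lambert series as a product *)

(** What remains of the quotient in [partial_fractions] at the pole Z = Q^(-m) once the factor 1 - Z
    Q^m is removed; negative powers of Q are cleared in pairs. *)
Definition pfcoef (F : fieldType) (x Q : F) M m : F :=
  \prod_(i < m) (x - Q ^+ i.+1) * \prod_(i < M - m) (1 - x * Q ^+ i) /
  (\prod_(i < m) (1 - Q ^+ i.+1) * \prod_(i < M - m) (1 - Q ^+ i.+1)).

(** In Z the numerator has smaller degree than the denominator, so there is no polynomial part. The
    induction multiplies by (1 - x Z Q^M)/(1 - Z Q^(M+1)), which adds one pole. *)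
Lemma partial_fractions (F : fieldType) (x Q Z : F) M :
  Q != 0 -> (forall i, Q ^+ i.+1 != 1) -> (forall j, (j <= M)%N -> Z * Q ^+ j != 1) ->
  \prod_(j < M) (1 - x * Z * Q ^+ j) / \prod_(j < M.+1) (1 - Z * Q ^+ j)
  = \sum_(m < M.+1) pfcoef x Q M m / (1 - Z * Q ^+ m).
Proof.
move=> Q0 Q1; have nz1 (a : F) : a != 1 -> 1 - a != 0.
  by rewrite subr_eq0 eq_sym.
elim: M Z => [|M IH] Z Z1.
  by rewrite !big_ord1 !big_ord0 /pfcoef subnn !big_ord0 !mul1r invr1 mul1r.
have ZM : 1 - Z * Q ^+ M.+1 != 0 by apply: nz1; apply: Z1.
rewrite big_ord_recr [in X in _ / X]big_ord_recr /= invfM mulrACA IH; last first.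
  by move=> j le_jM; apply: Z1; apply: leqW.
pose W := (Q ^+ M.+1)^-1.
(* The coefficient of the new pole comes from the induction hypothesis at that pole. *)
have last_coef : pfcoef x Q M.+1 M.+1 =
    (1 - x / Q) * \sum_(m < M.+1) pfcoef x Q M m / (1 - W * Q ^+ m).
  have QW j : (j <= M)%N -> W * Q ^+ j = (Q ^+ (M - j).+1)^-1.
    move=> le_jM; have e : Q ^+ M.+1 = Q ^+ (M - j).+1 * Q ^+ j.
      by rewrite -exprD; congr (_ ^+ _); lia.
    by rewrite /W e invfM -mulrA mulVf ?mulr1 ?expf_neq0.
  rewrite -IH => [|j le_jM]; last by rewrite QW // invr_eq1 Q1.
  have -> : (1 - x / Q) * (\prod_(j < M) (1 - x * W * Q ^+ j) /
      \prod_(j < M.+1) (1 - W * Q ^+ j)) =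
      \prod_(j < M.+1) (1 - x * W * Q ^+ j) / \prod_(j < M.+1) (1 - W * Q ^+ j).
    rewrite mulrA; congr (_ / _); rewrite [RHS]big_ord_recr /= mulrC; congr (_ * (1 - _)).
    by rewrite -mulrA QW // subnn.
  rewrite /pfcoef subnn !big_ord0 !mulr1 -!prodf_div [RHS](reindex_inj rev_ord_inj) /=.
  apply: eq_bigr => i _; rewrite -mulrA QW; last by have := ltn_ord i; lia.
  have -> : (M - (M.+1 - i.+1)).+1 = i.+1 by have := ltn_ord i; lia.
  by field; rewrite subr_eq0 Q1 nz1 // expf_neq0.
(* The comparison is now term by term: the new factor splits each old fraction into one at its own
   pole and one at the new pole. *)
rewrite [RHS]big_ord_recr /= last_coef mulr_sumr !mulr_suml -big_split /=.
apply: eq_bigr => -[m /= lt_mM] _.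
rewrite (_ : pfcoef x Q M.+1 m =
   pfcoef x Q M m * ((1 - x * Q ^+ (M - m)) / (1 - Q ^+ (M - m).+1))); last first.
  rewrite /pfcoef subSn // !(@big_ord_recr _ _ _ (M - m)) /=.
  field; rewrite nz1 ?Q1 //=.
  by apply/andP; split; apply/prodf_neq0 => i _; rewrite nz1.
have Zm : 1 - Z * Q ^+ m != 0 by apply: nz1; apply: Z1; apply: leqW.
have eM : Q ^+ M = Q ^+ m * Q ^+ (M - m) by rewrite -exprD; congr (_ ^+ _); lia.
move: Zm ZM (nz1 _ (Q1 (M - m)%N)); rewrite /W !exprS eM.
have := expf_neq0 m Q0; have := expf_neq0 (M - m) Q0.
move: (pfcoef _ _ _ _) (Q ^+ m) (Q ^+ (M - m)) => c A B B0 A0 h1 h2 h3.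
field; rewrite Q0 A0 B0 h1 h2 h3 /=.
by rewrite andbT -opprB oppr_eq0.
Qed.

(** * The centred finite form of Kronecker's identity *)

Definition fpoch (R : comNzRingType) (y : R) a k N := \prod_(i < N) (1 - y ^+ (a + k * i)).

Section FiniteKronecker.
Variables (F : fieldType) (y : F) (k : nat).
Hypotheses (y0 : y != 0) (y1 : forall i, y ^+ i.+1 != 1) (k_gt2 : (2 < k)%N).
Let Q := y ^+ k.
Let Q0 : Q != 0. Proof. exact: expf_neq0. Qed.

Let pfcoefE M m : pfcoef y Q M m =
  y ^+ m * (fpoch y (k - 1) k m * fpoch y 1 k (M - m) /
            (fpoch y k k m * fpoch y k k (M - m))).
Proof.
have kP n : \prod_(i < n) (1 - Q ^+ i.+1) = fpoch y k k n.
  by apply: eq_bigr => i _; rewrite -exprM mulnS.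
rewrite /pfcoef !kP mulrA mulrA; congr (_ * _ / _); last first.
  by apply: eq_bigr => i _; rewrite -exprM -exprS.
have -> : y ^+ m = \prod_(i < m) y by rewrite prodr_const card_ord.
rewrite -big_split; apply: eq_bigr => i _ /=.
rewrite mulrBr mulr1 -exprM -exprS; congr (_ - _ ^+ _); nia.
Qed.

Let upper a N L :
  \prod_(j < L) (1 - y ^+ a / Q ^+ N * Q ^+ (N + j)) = fpoch y a k L.
Proof.
apply: eq_bigr => j _; rewrite exprD mulrA divfK ?expf_neq0 //.
by rewrite exprD -exprM.
Qed.

Let lower_factor a i : (0 < a < k)%N ->
  1 - y ^+ a / Q ^+ i.+1 = - (y ^+ a / Q ^+ i.+1) * (1 - y ^+ (k - a + k * i)).
Proof.
move=> /andP[a0 ak]; have -> : Q ^+ i.+1 = y ^+ a * y ^+ (k - a + k * i).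
  by rewrite -exprM -exprD; congr (_ ^+ _); nia.
by field; rewrite !expf_neq0.
Qed.

Let lower_exp a N i : (i < N)%N -> y ^+ a / Q ^+ N * Q ^+ (N - i.+1) = y ^+ a / Q ^+ i.+1.
Proof.
move=> lt_iN; have -> : Q ^+ N = Q ^+ i.+1 * Q ^+ (N - i.+1).
  by rewrite -exprD; congr (_ ^+ _); lia.
by field; rewrite !expf_neq0.
Qed.

Let lower a N : (0 < a < k)%N ->
  \prod_(j < N) (1 - y ^+ a / Q ^+ N * Q ^+ j) =
  \prod_(i < N) - (y ^+ a / Q ^+ i.+1) * fpoch y (k - a) k N.
Proof.
move=> ak; rewrite (reindex_inj rev_ord_inj) /= -big_split; apply: eq_bigr => i _ /=.
by rewrite lower_exp // lower_factor.
Qed.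

(** Partial fractions with x = y, base Q = y^k, 2N + 1 poles and Z = y/Q^N. The poles of index N + n
    give the first sum, those of index N - n - 1 the second, whose minus sign comes from 1 - y^(-a)
    = -y^(-a) (1 - y^a). *)
Lemma finite_kronecker N :
  fpoch y 2 k N * fpoch y (k - 2) k N / (fpoch y 1 k N.+1 * fpoch y (k - 1) k N) =
  \sum_(n < N.+1) y ^+ n * (fpoch y (k - 1) k (N + n) * fpoch y 1 k (N - n) /
     (fpoch y k k (N + n) * fpoch y k k (N - n))) / (1 - y ^+ (1 + k * n))
  - \sum_(n < N) y ^+ ((k - 1) * n.+1 - 1) *
     (fpoch y (k - 1) k (N - n.+1) * fpoch y 1 k (N + n.+1) /
      (fpoch y k k (N - n.+1) * fpoch y k k (N + n.+1))) / (1 - y ^+ (k * n.+1 - 1)).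
Proof.
have yS n : (0 < n)%N -> 1 - y ^+ n != 0.
  by case: n => // n _; rewrite subr_eq0 eq_sym.
have Q1 i : Q ^+ i.+1 != 1.
  by rewrite -exprM; case: (k * i.+1)%N (leq_mul (ltnW (ltnW k_gt2)) (ltn0Sn i)).
pose Z := y ^+ 1 / Q ^+ N.
have ZU j : Z * Q ^+ (N + j) = y ^+ (1 + k * j).
  by rewrite /Z exprD mulrA divfK ?expf_neq0 // exprD -exprM.
have ZL j : (j < N)%N -> 1 - Z * Q ^+ (N - j.+1) =
    - (y / Q ^+ j.+1) * (1 - y ^+ (k * j.+1 - 1)).
  move=> lt_jN; rewrite /Z lower_exp // lower_factor ?expr1; last by lia.
  by congr (_ * (1 - _ ^+ _)); lia.
have Z1 j : (j <= N + N)%N -> Z * Q ^+ j != 1.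
  move=> le_j; rewrite eq_sym -subr_eq0; have [le_Nj|lt_jN] := leqP N j.
    by rewrite -(subnKC le_Nj) ZU yS.
  have -> : j = (N - (N - j.+1).+1)%N by lia.
  rewrite ZL ?mulf_neq0 ?oppr_eq0 ?yS ?mulf_neq0 ?invr_eq0 ?expf_neq0 //; nia.
have := partial_fractions y Q0 Q1 Z1.
have -> : y * Z = y ^+ 2 / Q ^+ N by rewrite /Z expr1 expr2 mulrA.
rewrite -addnS !big_split_ord /= upper [\prod_(i < N.+1) _]upper !lower; [|lia..].
(* The monomials released by the lower halves of numerator and denominator differ by one factor y
   per index; the resulting y^N is cancelled against the powers of y in [pfcoef]. *)
have -> : \prod_(i < N) - (y ^+ 2 / Q ^+ i.+1) =
          y ^+ N * \prod_(i < N) - (y ^+ 1 / Q ^+ i.+1).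
  have -> : y ^+ N = \prod_(i < N) y by rewrite prodr_const card_ord.
  rewrite -big_split; apply: eq_bigr => i _ /=.
  by rewrite expr1 expr2 mulrN mulrA.
set mono := \prod_(i < N) - _; have mono0 : mono != 0.
  by apply/prodf_neq0 => i _; rewrite oppr_eq0 mulf_neq0 ?invr_eq0 ?expf_neq0.
have fp0 a L : (0 < a)%N -> fpoch y a k L != 0.
  by move=> a0; apply/prodf_neq0 => i _; rewrite yS // addn_gt0 a0.
move=> e; apply: (mulfI (expf_neq0 N y0)).
transitivity (y ^+ N * mono * fpoch y (k - 2) k N * fpoch y 2 k N /
    (mono * fpoch y (k - 1) k N * fpoch y 1 k N.+1)).
  by field; rewrite mono0 !fp0 //; lia.
rewrite e addrC mulrBr !mulr_sumr -sumrN; congr (_ + _).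
  apply: eq_bigr => n _; rewrite pfcoefE ZU exprD.
  have -> : (N + N - (N + n) = N - n)%N by lia.
  by rewrite !mulrA.
rewrite (reindex_inj rev_ord_inj) /=; apply: eq_bigr => n _.
rewrite pfcoefE ZL // (_ : N + N - (N - n.+1) = N + n.+1)%N; last by have := ltn_ord n; lia.
move: (_ / (fpoch _ _ _ _ * _)) => C.
have e1 : Q ^+ n.+1 = y * y ^+ (k * n.+1 - 1).
  by rewrite -exprM -exprS; congr (_ ^+ _); nia.
have e2 : y ^+ N * y ^+ ((k - 1) * n.+1 - 1) = y ^+ (N - n.+1) * y ^+ (k * n.+1 - 1).
  by rewrite -!exprD; congr (_ ^+ _); have := ltn_ord n; nia.
have d0 : 1 - y ^+ (k * n.+1 - 1) != 0 by apply: yS; nia.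
rewrite !mulrA e2 e1; by field; rewrite d0 y0 expf_neq0 // oppr_eq0 oner_eq0.
Qed.
End FiniteKronecker.


(** * Lambert series and the limit of the finite identity *)

Lemma geomV a : (0 < a)%N -> (1 - q ^+ a)^-1 = fun n => (a %| n)%N%:R.
Proof.
move=> a0; set g := (X in _ = X); have u : 1 - q ^+ a \is a GRing.unit.
  by apply: ps_unit; rewrite psEB psE1 qXE eqxx ltn_eqF // subr0.
apply: (mulrI u); rewrite divrr //; apply: funext => n.
rewrite mulrBl mul1r psEB qXME psE1 /g; case: leqP => [le_an|lt_na].
  by rewrite dvdn_subl // subrr (gtn_eqF (leq_trans a0 le_an)).
rewrite subr0; case: n lt_na => [|n] lt_na; first by rewrite dvdn0.
by rewrite gtnNdvd.
Qed.

Lemma lambert_term b a n : (0 < a)%N ->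
  (q ^+ b / (1 - q ^+ a)) n = ((b <= n) && (a %| n - b))%N%:R.
Proof. by move=> a0; rewrite geomV // qXME; case: leqP. Qed.

(* The coefficient of q^s in the sum over all integers n of q^n / (1 - q^(k n + 1)). *)
Definition lambert k : ps := fun s =>
  \sum_(n < s.+1) ((k * n + 1 %| k * s + 1)%N%:R - (k * n + (k - 1) %| k * s + 1)%N%:R).

Lemma sum_tail0 a b (F : nat -> int) : (a <= b)%N ->
  (forall n, (a <= n)%N -> F n = 0) -> \sum_(n < b) F n = \sum_(n < a) F n.
Proof.
move=> le_ab F0; rewrite -(big_mkord xpredT F) (big_cat_nat (n := a)) //= big_mkord.
by rewrite [X in _ + X]big_nat [X in _ + X]big1 ?addr0 // => n /andP[/F0].
Qed.

(** The term of index n >= 0 contributes to q^s when kn + 1 divides s - n. As ks + 1 = k(s - n) +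
    (kn + 1) and kn + 1 is prime to k, this means that kn + 1 divides ks + 1. Negative indices give
    the divisors congruent to -1 modulo k. *)
Lemma lambertE k N : (2 < k)%N -> eqm N
  (\sum_(n < N.+1) q ^+ n / (1 - q ^+ (1 + k * n)) -
   \sum_(n < N) q ^+ ((k - 1) * n.+1 - 1) / (1 - q ^+ (k * n.+1 - 1))) (lambert k).
Proof.
move=> k2 s lt_sN; rewrite psEB !psE_sum /lambert sumrB.
have pos n : (q ^+ n / (1 - q ^+ (1 + k * n))) s = (k * n + 1 %| k * s + 1)%N%:R.
  rewrite lambert_term // addnC; congr (_%:R); congr nat_of_bool.
  case: leqP => [le_ns|lt_sn] /=; last by rewrite gtnNdvd //; nia.
  have -> : (k * s + 1 = k * (s - n) + (k * n + 1))%N by nia.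
  by rewrite dvdn_addl // Gauss_dvdr // coprime_sym /coprime mulnC gcdnMDl gcdn1.
have neg n : (q ^+ ((k - 1) * n.+1 - 1) / (1 - q ^+ (k * n.+1 - 1))) s =
    (k * n + (k - 1) %| k * s + 1)%N%:R.
  have -> : (k * n.+1 - 1 = k * n + (k - 1))%N by nia.
  rewrite lambert_term; last by lia.
  congr (_%:R); congr nat_of_bool; case: leqP => [le_bs|lt_sb] /=.
    have -> : (k * s + 1 = k * (s - ((k - 1) * n.+1 - 1)) + (k - 1) * (k * n + (k - 1)))%N.
      by nia.
    rewrite dvdn_addl; last exact: dvdn_mull.
    rewrite Gauss_dvdr //.
    rewrite coprime_sym /coprime mulnC gcdnMDl -[k in gcdn k](subnK (ltnW (ltnW k2))) addn1.
    by rewrite -/(coprime _ _) coprimeSn.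
  (* A cofactor c of such a divisor satisfies c = -1 modulo k, hence c >= k - 1, which forces s to
     reach the starting exponent. *)
  apply/esym/negbTE/negP => /dvdnP[c ec].
  have kc : (k %| c.+1)%N.
    have e : (c.+1 + k * s = k * (c * n.+1))%N by nia.
    by rewrite -(dvdn_addl (n := k * s)) ?dvdn_mulr // e dvdn_mulr.
  by have := dvdn_leq (ltn0Sn c) kc; nia.
congr (_ - _).
  transitivity (\sum_(n < N.+1) ((k * n + 1 %| k * s + 1)%N%:R : int)).
    by apply: eq_bigr => n _; apply: pos.
  rewrite (@sum_tail0 s.+1 _ (fun n => (k * n + 1 %| k * s + 1)%N%:R)) //; first by lia.
  by move=> n lt_sn; rewrite gtnNdvd //; nia.
transitivity (\sum_(n < N) ((k * n + (k - 1) %| k * s + 1)%N%:R : int)).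
  by apply: eq_bigr => n _; apply: neg.
rewrite (@sum_tail0 s.+1 _ (fun n => (k * n + (k - 1) %| k * s + 1)%N%:R)) //.
by move=> n lt_sn; rewrite gtnNdvd //; nia.
Qed.

Lemma tofrac_inj : injective (@tofrac ps).
Proof. by move=> f g /eqP; rewrite tofrac_eq => /eqP. Qed.

Lemma rmorph_fpoch (R S : comNzRingType) (h : {rmorphism R -> S}) y a k N :
  h (fpoch y a k N) = fpoch (h y) a k N.
Proof.
rewrite rmorph_prod; apply: eq_bigr => i _.
by rewrite rmorphB rmorph1 rmorphXn.
Qed.

Lemma fpoch0 a k N : (0 < a)%N -> fpoch q a k N 0%N = 1.
Proof.
move=> a0; elim: N => [|N IH]; first by rewrite /fpoch big_ord0.
have -> : fpoch q a k N.+1 = fpoch q a k N * (1 - q ^+ (a + k * N)) by exact: big_ord_recr.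
by rewrite psEM0 IH mul1r psEB psE1 qXE eqxx ltn_eqF ?addn_gt0 ?a0 // subr0.
Qed.

Lemma fpochE a k N M : (0 < a)%N -> (0 < k)%N -> (N <= M)%N ->
  eqm N (fpoch q a k M) (poch a k).
Proof.
move=> a0 k0 le_NM; apply: eqm_sym; apply: eqm_le (prodinfE (near1_poch a0 k0)); lia.
Qed.

Lemma kronecker k : (2 < k)%N ->
  poch 2 k * poch (k - 2) k / (poch 1 k * poch (k - 1) k) =
  poch (k - 1) k * poch 1 k / poch k k ^+ 2 * lambert k.
Proof.
move=> k2; have k0 : (0 < k)%N by lia.
have u a n : (0 < a)%N -> fpoch q a k n \is a GRing.unit.
  by move=> a0; apply/ps_unit/fpoch0.
have uq n : (0 < n)%N -> 1 - q ^+ n \is a GRing.unit.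
  by move=> n0; apply: ps_unit; rewrite psEB psE1 qXE eqxx ltn_eqF // subr0.
have q0 : tofrac q != 0.
  rewrite tofrac_eq0 -[q]expr1; apply/eqP => /(congr1 (fun f : ps => f 1%N)).
  by rewrite qXE.
have q1 i : tofrac q ^+ i.+1 != 1.
  rewrite -tofracXn -tofrac1 tofrac_eq; apply/eqP => /(congr1 (fun f : ps => f 0%N)).
  by rewrite qXE.
(* The finite identity at y = q holds in the fraction field, where q is invertible; all its
   denominators are units of [ps], so it descends. *)
have fin N : fpoch q 2 k N * fpoch q (k - 2) k N /
      (fpoch q 1 k N.+1 * fpoch q (k - 1) k N) =
    \sum_(n < N.+1) q ^+ n * (fpoch q (k - 1) k (N + n) * fpoch q 1 k (N - n) /
       (fpoch q k k (N + n) * fpoch q k k (N - n))) / (1 - q ^+ (1 + k * n))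
    - \sum_(n < N) q ^+ ((k - 1) * n.+1 - 1) *
       (fpoch q (k - 1) k (N - n.+1) * fpoch q 1 k (N + n.+1) /
        (fpoch q k k (N - n.+1) * fpoch q k k (N + n.+1))) / (1 - q ^+ (k * n.+1 - 1)).
  apply: tofrac_inj; rewrite rmorphB !rmorph_sum /= rmorph_div ?unitrM ?u //=; try lia.
  rewrite !rmorphM /= !rmorph_fpoch finite_kronecker //; congr (_ - _).
    apply: eq_bigr => n _; rewrite !rmorphM !rmorphV ?unitrM ?u ?uq //=.
    by rewrite !rmorphM /= !rmorph_fpoch rmorphB rmorph1 !rmorphXn.
  apply: eq_bigr => n _; rewrite !rmorphM !rmorphV ?unitrM ?u ?uq //=; last by nia.
  by rewrite !rmorphM /= !rmorph_fpoch rmorphB rmorph1 !rmorphXn.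
pose C := poch (k - 1) k * poch 1 k / (poch k k * poch k k).
have CE N a b : (N <= a)%N -> (N <= b)%N -> eqm N
    (fpoch q (k - 1) k a * fpoch q 1 k b / (fpoch q k k a * fpoch q k k b)) C.
  move=> Na Nb; apply: eqmM; first by apply: eqmM; apply: fpochE; lia.
  apply: eqmV; rewrite ?psEM0 ?fpoch0 ?poch0 ?mulr1 //.
  by apply: eqmM; apply: fpochE.
apply: eqm_eq => N; exists N => //.
(* The finite identity is used at N + N: for n < N all its truncated products have length at least
   N, so the coefficient is C modulo q^N; for n >= N the power of q in front kills the term. *)
pose L := \sum_(n < (N + N).+1) q ^+ n / (1 - q ^+ (1 + k * n)) -
  \sum_(n < N + N) q ^+ ((k - 1) * n.+1 - 1) / (1 - q ^+ (k * n.+1 - 1)).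
apply: (@eqm_trans _ _ (C * L)); last first.
  apply: eqmM; first by rewrite expr2.
  by apply: eqm_le (@lambertE k (N + N) k2); rewrite leq_addr.
apply: eqm_trans (_ : eqm N (fpoch q 2 k (N + N) * fpoch q (k - 2) k (N + N) /
   (fpoch q 1 k (N + N).+1 * fpoch q (k - 1) k (N + N))) _).
  apply: eqm_sym; apply: eqmM; first by apply: eqmM; apply: fpochE; lia.
  apply: eqmV; rewrite ?psEM0 ?fpoch0 ?poch0 ?mulr1 //; try lia.
  by apply: eqmM; apply: fpochE; lia.
rewrite fin /L mulrBr !mulr_sumr; apply: eqmD; last apply: eqmN.
  apply: eqm_sum => n _; rewrite [X in eqm _ _ X]mulrCA -[X in eqm _ X _]mulrA.
  have [le_Nn|lt_nN] := leqP N n.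
    by apply: eqm_trans (eqm_sym (qXM_eqm0 _ le_Nn)); apply: qXM_eqm0.
  by apply: eqmM => //; apply: eqmM => //; apply: CE; lia.
apply: eqm_sum => n _; rewrite [X in eqm _ _ X]mulrCA -[X in eqm _ X _]mulrA.
have [le_Nn|lt_nN] := leqP N n.
  have le : (N <= (k - 1) * n.+1 - 1)%N by nia.
  by apply: eqm_trans (eqm_sym (qXM_eqm0 _ le)); apply: qXM_eqm0.
apply: eqmM => //; apply: eqmM => //.
apply: CE; lia.
Qed.

Lemma frac_neq0 (f : ps) : f 0%N != 0 -> tofrac f != 0.
Proof. by rewrite tofrac_eq0; apply: contraNneq => ->; rewrite psE0. Qed.

Lemma kronecker_frac k : (2 < k)%N ->
  tofrac (poch 2 k) * tofrac (poch (k - 2) k) / (tofrac (poch 1 k) * tofrac (poch (k - 1) k)) =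
  tofrac (poch (k - 1) k) * tofrac (poch 1 k) / tofrac (poch k k) ^+ 2 * tofrac (lambert k).
Proof.
move=> k2; have := congr1 (@tofrac ps) (kronecker k2).
have u a : (0 < a)%N -> poch a k \is a GRing.unit.
  by move=> a0; apply/ps_unit/poch0 => //; lia.
rewrite !rmorphM !rmorphV ?unitrM ?unitrX ?u //=; try lia.
by rewrite !rmorphM.
Qed.

Lemma lambert3_prod : lambert 3 * E = ps_dil 3 E ^+ 3.
Proof.
have := kronecker_frac (isT : (2 < 3)%N); rewrite /= => K.
apply: tofrac_inj; rewrite dilE_poch // E_poch (@poch_block 1 1 3) // !big_ord_recl big_ord0.
rewrite mulr1 /= rmorphXn !rmorphM /=; move: K.
have p0 a : (0 < a)%N -> tofrac (poch a 3) != 0.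
  by move=> a0; apply: frac_neq0; rewrite poch0.
(* The products become variables of an arbitrary field, so that [field] meets only atoms. For k = 3
   the left side of the identity is 1. *)
suff alg (F : fieldType) (p1 p2 p3 L : F) : p1 != 0 -> p2 != 0 -> p3 != 0 ->
    p2 * p1 / (p1 * p2) = p2 * p1 / p3 ^+ 2 * L -> L * (p1 * (p2 * p3)) = p3 ^+ 3.
  by apply: alg; apply: p0.
move=> n1 n2 n3 K.
have -> : L = (p2 * p1 / p3 ^+ 2 * L) * (p3 ^+ 2 / (p1 * p2)) by field; rewrite n1 n2 n3.
by rewrite -K; field; rewrite n1 n2.
Qed.

Lemma lambert6_prod : lambert 6 * E ^+ 2 * ps_dil 6 E = ps_dil 2 E ^+ 3 * ps_dil 3 E ^+ 2.
Proof.
have := kronecker_frac (isT : (2 < 6)%N); rewrite /= => K.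
apply: tofrac_inj; rewrite !dilE_poch // E_poch.
rewrite (@poch_block 1 1 6) // (@poch_block 2 2 3) // (@poch_block 3 3 2) //.
rewrite !big_ord_recl !big_ord0 !mulr1 /= !(rmorphXn, rmorphM) /=; move: K.
have p0 a : (0 < a)%N -> tofrac (poch a 6) != 0.
  by move=> a0; apply: frac_neq0; rewrite poch0.
suff alg (F : fieldType) (p1 p2 p3 p4 p5 p6 L : F) : p1 != 0 -> p5 != 0 -> p6 != 0 ->
    p2 * p4 / (p1 * p5) = p5 * p1 / p6 ^+ 2 * L ->
    L * (p1 * (p2 * (p3 * (p4 * (p5 * p6))))) ^+ 2 * p6 =
    (p2 * (p4 * p6)) ^+ 3 * (p3 * p6) ^+ 2.
  by apply: alg; apply: p0.
move=> n1 n5 n6 K.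
have -> : L = (p5 * p1 / p6 ^+ 2 * L) * (p6 ^+ 2 / (p1 * p5)) by field; rewrite n1 n5 n6.
by rewrite -K; field; rewrite n1 n5.
Qed.

(** * The 2-dissection of E(q^3)^3 / E(q) *)

Definition chi3 (d : nat) : int := (d %% 3 == 1)%N%:R - (d %% 3 == 2)%N%:R.

Definition chi3_sum (N : nat) : int := \sum_(d < N.+1) (d %| N)%N%:R * chi3 d.

Lemma chi3_sumE N B : (0 < N < B)%N -> chi3_sum N = \sum_(d < B) (d %| N)%N%:R * chi3 d.
Proof.
move=> /andP[N0 lt_NB]; apply/esym.
apply: (@sum_tail0 _ _ (fun d => (d %| N)%N%:R * chi3 d)) => // n lt_Nn.
by rewrite gtnNdvd // mul0r.
Qed.

Lemma lambert3E s : lambert 3 s = chi3_sum (3 * s + 1).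
Proof.
rewrite (@chi3_sumE _ (s.+1 * 3)); last by lia.
rewrite (big_block _ _ _ (fun d => (d %| _)%N%:R * chi3 d)); apply: eq_bigr => n _.
rewrite !big_ord_recl big_ord0 /= /bump /= [(n * 3)%N]mulnC.
have chiE i : chi3 (3 * n + i) = chi3 i by rewrite /chi3 mulnC modnMDl.
by rewrite !chiE /chi3 /=; ring.
Qed.

(** Since 6s + 1 is odd, only divisors congruent to 1, 3 or 5 modulo 6 can occur, and [chi3]
    vanishes on those congruent to 3. *)
Lemma lambert6E s : lambert 6 s = chi3_sum (6 * s + 1).
Proof.
rewrite (@chi3_sumE _ (s.+1 * 6)); last by lia.
rewrite (big_block _ _ _ (fun d => (d %| _)%N%:R * chi3 d)); apply: eq_bigr => n _.
rewrite !big_ord_recl big_ord0 /= /bump /=.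
have chiE i : chi3 (n * 6 + i) = chi3 i.
  by rewrite /chi3 (_ : n * 6 + i = n * 2 * 3 + i)%N ?modnMDl //; lia.
have dvF i : ~~ odd i -> (n * 6 + i %| 6 * s + 1)%N = false.
  move=> i2; apply: contraTF (dvdnn 2) => dv; have : (2 %| 6 * s + 1)%N.
    by apply: dvdn_trans dv; rewrite dvdn2; lia.
  by rewrite dvdn2; lia.
rewrite !chiE (dvF 2%N) // (dvF 4%N) // (dvF 0%N) // [(6 * n)%N]mulnC.
by rewrite /chi3 /=; ring.
Qed.

Definition chi3_odd (N B : nat) : int := \sum_(a < B) (2 * a + 1 %| N)%N%:R * chi3 (2 * a + 1).

Lemma chi3_oddE N B : (0 < N < B)%N -> chi3_odd N B = chi3_odd N N.+1.
Proof.
move=> /andP[N0 lt_NB].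
apply: (@sum_tail0 _ _ (fun a => (2 * a + 1 %| N)%N%:R * chi3 (2 * a + 1))) => // n lt_Nn.
by rewrite gtnNdvd ?mul0r //; lia.
Qed.

Lemma chi3_double d : chi3 (2 * d) = - chi3 d.
Proof.
rewrite /chi3; have : (d %% 3 < 3)%N by rewrite ltn_mod.
rewrite -modnMmr; case: (d %% 3)%N => [|[|[|]]] //.
Qed.

Lemma odd_dvd_double a M : (2 * a + 1 %| 2 * M)%N = (2 * a + 1 %| M)%N.
Proof. by rewrite Gauss_dvdr // coprimen2 oddD oddM. Qed.

(** A divisor of 2M is an odd divisor of M or twice a divisor a of M, and [chi3] changes sign under
    doubling. *)
Lemma chi3_sum_double M : (0 < M)%N ->
  chi3_sum (2 * M) = chi3_odd M M.+1 - chi3_sum M.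
Proof.
move=> M0; rewrite (@chi3_sumE (2 * M) (M.+1 * 2)); last by lia.
rewrite (big_block _ _ _ (fun d => (d %| _)%N%:R * chi3 d)).
rewrite /chi3_odd /chi3_sum -sumrB; apply: eq_bigr => a _.
rewrite !big_ord_recl big_ord0 /= /bump /= addn0 addr0 [(a * 2)%N]mulnC odd_dvd_double.
by rewrite dvdn_pmul2l // chi3_double; ring.
Qed.

Lemma chi3_sum_odd M : odd M -> chi3_sum M = chi3_odd M M.+1.
Proof.
move=> oddM; have M0 := odd_gt0 oddM.
rewrite (@chi3_sumE M (M.+1 * 2)); last by lia.
rewrite (big_block _ _ _ (fun d => (d %| _)%N%:R * chi3 d)).
apply: eq_bigr => a _; rewrite !big_ord_recl big_ord0 /= /bump /= addn0 addr0 [(a * 2)%N]mulnC.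
rewrite (_ : (2 * a %| M)%N = false) ?mul0r ?add0r //.
by apply: contraTF oddM => /(dvdn_trans (dvdn_mulr a (dvdnn 2))); rewrite dvdn2.
Qed.

Lemma chi3_sum_2odd M : odd M -> chi3_sum (2 * M) = 0.
Proof.
by move=> oddM; rewrite chi3_sum_double ?odd_gt0 // chi3_sum_odd // subrr.
Qed.

Lemma chi3_sum_4 M : (0 < M)%N -> chi3_sum (4 * M) = chi3_sum M.
Proof.
move=> M0; rewrite (_ : 4 * M = 2 * (2 * M))%N; last by lia.
rewrite chi3_sum_double; last by lia.
have -> : chi3_odd (2 * M) (2 * M).+1 = chi3_odd M (2 * M).+1.
  by apply: eq_bigr => a _; rewrite odd_dvd_double.
rewrite chi3_oddE; last by lia.
by rewrite chi3_sum_double // subKr.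
Qed.

Lemma lambert3_dissection :
  lambert 3 = ps_dil 2 (lambert 6) + q * ps_dil 4 (lambert 3).
Proof.
apply: funext => n; rewrite psED -[q]expr1 qXME lambert3E.
have [n2|n2] := boolP (odd n).
  have -> : n = (n./2.*2.+1)%N by lia.
  move: n./2 => s; rewrite {1}/ps_dil dvdn2 /= odd_double /= add0r subn1 /=.
  (* For n = 2s + 1, the number 3n + 1 is 4(3j + 1) when s = 2j, and twice an odd number when s is
     odd. *)
  have -> : (3 * s.*2.+1 + 1 = 2 * (3 * s + 2))%N by lia.
  rewrite /ps_dil; case: ifP => [/dvdnP[j]|dvF].
    move=> e; have -> : s = (2 * j)%N by lia.
    rewrite (_ : 2 * (3 * (2 * j) + 2) = 4 * (3 * j + 1))%N; last by lia.
    rewrite chi3_sum_4; last by lia.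
    rewrite lambert3E; congr (chi3_sum (3 * _ + 1)).
    by rewrite (_ : (2 * j).*2 = j * 4)%N ?mulnK; lia.
  rewrite chi3_sum_2odd //; move/negbT: dvF; apply: contraR => s_even.
  by apply/dvdnP; exists (s./2); lia.
have -> : n = (2 * n./2)%N by lia.
move: n./2 => s; rewrite dilE // lambert6E mulnA [X in _ + X](_ : _ = 0) ?addr0 //.
case: ifP => // s0; rewrite /ps_dil ifF //; apply/negbTE/negP.
by move=> /dvdnP[j]; lia.
Qed.

(** * Eta quotients of level 12 *)

Lemma dil_1 f : ps_dil 1 f = f.
Proof. by apply: funext => n; rewrite /ps_dil dvd1n divn1. Qed.

Definition Ed n := ps_dil n E.

Lemma Ed1 : Ed 1 = E. Proof. exact: dil_1. Qed.
Lemma Ed0 n : Ed n 0%N = 1. Proof. by rewrite /Ed dilE0 E0. Qed.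
Lemma Ed_unit n : Ed n \is a GRing.unit. Proof. by apply/ps_unit/Ed0. Qed.
Lemma dil_Ed a n : ps_dil a.+1 (Ed n.+1) = Ed (a.+1 * n.+1).
Proof. by rewrite /Ed dil_dil. Qed.

Lemma psEX0 (f : ps) k : (f ^+ k) 0%N = f 0%N ^+ k.
Proof. by elim: k => // k IH; rewrite exprS psEM0 IH exprS. Qed.

Lemma psEV0 (f : ps) : f 0%N = 1 -> (f^-1) 0%N = 1.
Proof.
move=> f0; have := congr1 (fun g : ps => g 0%N) (divrr (ps_unit f0)).
by rewrite psEM0 f0 mul1r.
Qed.

Definition Edunits := (unitrM, unitrX, unitrV, Ed_unit).
Definition Ed_const := (psEM0, psEX0, Ed0, expr1n, mulr1).

Lemma xiE : xi = Ed 2 ^+ 5 * Ed 6 / (Ed 1 * Ed 3 ^+ 5).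
Proof.
rewrite Ed1 /xi !ps_powE -!/(Ed _) -ps_invE //.
by rewrite !Ed_const E0 ?mulr1.
Qed.

Lemma gammaE : gamma = Ed 1 ^+ 5 * Ed 2 ^+ 5 * Ed 6 ^+ 5 / Ed 3 ^+ 15.
Proof.
rewrite Ed1 /gamma !ps_powE -!/(Ed _) -ps_invE //.
by rewrite !Ed_const.
Qed.

Lemma gamma0 : gamma 0%N = 1.
Proof. by rewrite gammaE psEM0 psEV0 !Ed_const. Qed.

Lemma xi0 : xi 0%N = 1.
Proof. by rewrite xiE psEM0 psEV0 !Ed_const. Qed.

Lemma kappaE : kappa = ps_dil 2 gamma ^+ 2 / gamma.
Proof. by rewrite /kappa ps_powE ps_invE // gamma0. Qed.

Definition e n : {fraction ps} := tofrac (Ed n).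
Definition es n : {fraction ps} := tofrac (sgn (Ed n)).

Lemma e0 n : e n != 0.
Proof. by apply: frac_neq0; rewrite Ed0. Qed.

Lemma frac_div (f g : ps) : g \is a GRing.unit -> tofrac (f / g) = tofrac f / tofrac g.
Proof. exact: rmorph_div. Qed.

Lemma es_even n : ~~ odd n -> es n = e n.
Proof. by move=> n2; rewrite /es /Ed sgn_dil_even. Qed.

Lemma es_odd n : odd n -> es n = e (2 * n) ^+ 3 / (e n * e (4 * n)).
Proof.
move=> n1; have n0 := odd_gt0 n1; apply: (canRL (mulfK _)); first by rewrite mulf_neq0 ?e0.
rewrite /e /es -tofracXn -!tofracM /=; congr tofrac; rewrite /Ed.
have := congr1 (ps_dil n) sgn_E; case: n n1 n0 => // n n1 _.
rewrite !(rmorphXn, rmorphM) /= !dil_dil // [(_ * 2)%N]mulnC [(_ * 4)%N]mulnC.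
by rewrite sgn_dil_odd // mulrA.
Qed.

(** * The series r, s, X and the relations among them *)

Definition r : ps := Ed 2 * Ed 4 ^+ 2 * Ed 12 ^+ 2 * Ed 3 ^+ 3 / (Ed 1 * Ed 6 ^+ 7).
Definition s : ps := sgn r.
Definition X : ps := ps_dil 2 xi.

Lemma r0 : r 0%N = 1.
Proof. by rewrite /r psEM0 psEV0 !Ed_const. Qed.

Lemma s0 : s 0%N = 1.
Proof. by rewrite /s sgnE0 r0. Qed.

Lemma frac_xi : tofrac xi = e 2 ^+ 5 * e 6 / (e 1 * e 3 ^+ 5).
Proof. by rewrite xiE frac_div ?Edunits // !(rmorphXn, rmorphM). Qed.

Lemma frac_X : tofrac X = e 4 ^+ 5 * e 12 / (e 2 * e 6 ^+ 5).
Proof.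
have -> : X = Ed 4 ^+ 5 * Ed 12 / (Ed 2 * Ed 6 ^+ 5).
  by rewrite /X xiE rmorph_div ?Edunits //= !(rmorphXn, rmorphM) /= !dil_Ed.
by rewrite frac_div ?Edunits // !(rmorphXn, rmorphM).
Qed.

Lemma frac_r : tofrac r = e 2 * e 4 ^+ 2 * e 12 ^+ 2 * e 3 ^+ 3 / (e 1 * e 6 ^+ 7).
Proof. by rewrite /r frac_div ?Edunits // !(rmorphXn, rmorphM). Qed.

Lemma frac_s : tofrac s = e 1 * e 4 ^+ 3 * e 6 ^+ 2 / (e 2 ^+ 2 * e 3 ^+ 3 * e 12).
Proof.
have -> : tofrac s = es 2 * es 4 ^+ 2 * es 12 ^+ 2 * es 3 ^+ 3 / (es 1 * es 6 ^+ 7).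
  have -> : s = sgn (Ed 2 * Ed 4 ^+ 2 * Ed 12 ^+ 2 * Ed 3 ^+ 3) / sgn (Ed 1 * Ed 6 ^+ 7).
    by rewrite /s /r rmorph_div ?Edunits.
  rewrite frac_div; last by rewrite rmorph_unit ?Edunits.
  by rewrite !(rmorphXn, rmorphM).
rewrite (@es_even 2) // (@es_even 4) // (@es_even 6) // (@es_even 12) // !es_odd //.
suff alg (F : fieldType) (e1 e2 e3 e4 e6 e12 : F) : e1 != 0 -> e2 != 0 -> e3 != 0 ->
    e4 != 0 -> e6 != 0 -> e12 != 0 ->
    e2 * e4 ^+ 2 * e12 ^+ 2 * (e6 ^+ 3 / (e3 * e12)) ^+ 3 /
      (e2 ^+ 3 / (e1 * e4) * e6 ^+ 7) =
    e1 * e4 ^+ 3 * e6 ^+ 2 / (e2 ^+ 2 * e3 ^+ 3 * e12).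
  by apply: alg; apply: e0.
by move=> *; field; do ?[apply/andP; split].
Qed.

Lemma rs : r * s = X.
Proof.
apply: tofrac_inj; rewrite tofracM frac_r frac_s frac_X.
suff alg (F : fieldType) (e1 e2 e3 e4 e6 e12 : F) : e1 != 0 -> e2 != 0 -> e3 != 0 ->
    e4 != 0 -> e6 != 0 -> e12 != 0 ->
    e2 * e4 ^+ 2 * e12 ^+ 2 * e3 ^+ 3 / (e1 * e6 ^+ 7) *
    (e1 * e4 ^+ 3 * e6 ^+ 2 / (e2 ^+ 2 * e3 ^+ 3 * e12)) =
    e4 ^+ 5 * e12 / (e2 * e6 ^+ 5).
  by apply: alg; apply: e0.
by move=> *; field; do ?[apply/andP; split].
Qed.

Lemma frac_lambert3 : tofrac (lambert 3) = e 3 ^+ 3 / e 1.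
Proof.
apply: (canRL (mulfK (e0 1))); rewrite /e -tofracXn -tofracM /= Ed1.
by rewrite lambert3_prod.
Qed.

Lemma frac_lambert6 : tofrac (lambert 6) = e 2 ^+ 3 * e 3 ^+ 2 / (e 1 ^+ 2 * e 6).
Proof.
apply: (canRL (mulfK _)); first by rewrite mulf_neq0 ?expf_neq0 ?e0.
by rewrite /e -!tofracXn -!tofracM /= Ed1 mulrA lambert6_prod.
Qed.

Lemma frac_dil2_lambert6 :
  tofrac (ps_dil 2 (lambert 6)) = e 4 ^+ 3 * e 6 ^+ 2 / (e 2 ^+ 2 * e 12).
Proof.
apply: (canRL (mulfK _)); first by rewrite mulf_neq0 ?expf_neq0 ?e0.
have := congr1 (ps_dil 2) lambert6_prod; rewrite -Ed1 -!/(Ed _).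
rewrite !(rmorphXn, rmorphM) /= !dil_Ed => h.
by rewrite /e -!tofracXn -!tofracM /= mulrA h.
Qed.

Lemma frac_dil2_lambert3 : tofrac (ps_dil 2 (lambert 3)) = e 6 ^+ 3 / e 2.
Proof.
apply: (canRL (mulfK (e0 2))); have := congr1 (ps_dil 2) lambert3_prod.
rewrite -Ed1 -!/(Ed _) !(rmorphXn, rmorphM) /= !dil_Ed => h.
by rewrite /e -tofracXn -tofracM /= h.
Qed.

Lemma frac_dil4_lambert3 : tofrac (ps_dil 4 (lambert 3)) = e 12 ^+ 3 / e 4.
Proof.
apply: (canRL (mulfK (e0 4))); have := congr1 (ps_dil 4) lambert3_prod.
rewrite -Ed1 -!/(Ed _) !(rmorphXn, rmorphM) /= !dil_Ed => h.
by rewrite /e -tofracXn -tofracM /= h.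
Qed.

Lemma U_lambert3 : U (lambert 3) = lambert 6.
Proof.
by apply: funext => n; rewrite /U lambert3E lambert6E mulnA.
Qed.

(** The factors of odd index in r are exactly E_3^3/E_1, that is [lambert 3]; the rest is a series
    in q^2 and leaves [U]. *)
Lemma U_r : U r = xi.
Proof.
pose h := Ed 1 * Ed 2 ^+ 2 * Ed 6 ^+ 2 / Ed 3 ^+ 7.
have -> : r = lambert 3 * ps_dil 2 h.
  rewrite /h rmorph_div ?Edunits //= !(rmorphXn, rmorphM) /= !dil_Ed.
  apply: tofrac_inj; rewrite frac_r tofracM frac_div ?Edunits // frac_lambert3.
  rewrite !(tofracXn, tofracM) -!/(e _).
  suff alg (F : fieldType) (e1 e2 e3 e4 e6 e12 : F) : e1 != 0 -> e6 != 0 ->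
      e2 * e4 ^+ 2 * e12 ^+ 2 * e3 ^+ 3 / (e1 * e6 ^+ 7) =
      e3 ^+ 3 / e1 * (e2 * e4 ^+ 2 * e12 ^+ 2 / e6 ^+ 7).
    by apply: alg; apply: e0.
  by move=> *; field; do ?[apply/andP; split].
rewrite UM_dil U_lambert3; apply: tofrac_inj.
rewrite tofracM frac_xi frac_div ?Edunits // frac_lambert6 !(tofracXn, tofracM) -!/(e _).
suff alg (F : fieldType) (e1 e2 e3 e6 : F) : e1 != 0 -> e3 != 0 -> e6 != 0 ->
    e2 ^+ 3 * e3 ^+ 2 / (e1 ^+ 2 * e6) * (e1 * e2 ^+ 2 * e6 ^+ 2 / e3 ^+ 7) =
    e2 ^+ 5 * e6 / (e1 * e3 ^+ 5).
  by apply: alg; apply: e0.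
by move=> *; field; do ?[apply/andP; split].
Qed.

Lemma r_plus_s : r + s = X *+ 2.
Proof. by rewrite /X -U_r dil2_U. Qed.

Lemma s_sqr : s ^+ 2 = X * s *+ 2 - X.
Proof.
have -> : X * s *+ 2 = X *+ 2 * s by rewrite mulrnAl.
by rewrite -r_plus_s -rs; ring.
Qed.

(** With a and b the two parts of the dissection, (a + qb)(a - qb) = a^2 - q^2 b^2 is a series in
    q^2, and [J] is this identity with q^2 replaced by q. *)
Lemma xi_sub1 : tofrac xi =
  1 + tofrac q * e 1 ^+ 3 * e 6 ^+ 9 / (e 2 ^+ 3 * e 3 ^+ 9).
Proof.
pose Pi := Ed 3 ^+ 9 * Ed 2 / (Ed 1 ^+ 3 * Ed 6 ^+ 3).
have J : lambert 6 ^+ 2 - q * ps_dil 2 (lambert 3) ^+ 2 = Pi.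
  have dilPi : ps_dil 2 Pi = Ed 6 ^+ 9 * Ed 4 / (Ed 2 ^+ 3 * Ed 12 ^+ 3).
    by rewrite /Pi rmorph_div ?Edunits //= !(rmorphXn, rmorphM) /= !dil_Ed.
  apply: (@dil_inj 2) => //; rewrite dilPi rmorphB !(rmorphXn, rmorphM) /= dil_q // dil_dil //.
  have -> : ps_dil 2 (lambert 6) ^+ 2 - q ^+ 2 * ps_dil (2 * 2) (lambert 3) ^+ 2 =
            lambert 3 * sgn (lambert 3).
    have -> : sgn (lambert 3) = ps_dil 2 (lambert 6) - q * ps_dil 4 (lambert 3).
      rewrite {1}lambert3_dissection (rmorphD sgn) (rmorphM sgn) /= sgn_q !sgn_dil_even //.
      by rewrite mulNr.
    rewrite {2}lambert3_dissection -[(2 * 2)%N]/4%N; ring.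
  apply: tofrac_inj; rewrite tofracM frac_div ?Edunits // !(tofracXn, tofracM) -!/(e _).
  have -> : tofrac (sgn (lambert 3)) = es 3 ^+ 3 / es 1.
    apply: (canRL (mulfK _)).
      by rewrite es_odd // mulf_neq0 ?invr_eq0 ?mulf_neq0 ?expf_neq0 ?e0.
    rewrite /es -tofracXn -tofracM /=; congr tofrac.
    by rewrite -rmorphXn -rmorphM /= Ed1 lambert3_prod.
  rewrite frac_lambert3 !es_odd //.
  suff alg (F : fieldType) (e1 e2 e3 e4 e6 e12 : F) : e1 != 0 -> e2 != 0 -> e3 != 0 ->
      e4 != 0 -> e6 != 0 -> e12 != 0 ->
      e3 ^+ 3 / e1 * ((e6 ^+ 3 / (e3 * e12)) ^+ 3 / (e2 ^+ 3 / (e1 * e4))) =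
      e6 ^+ 9 * e4 / (e2 ^+ 3 * e12 ^+ 3).
    by apply: alg; apply: e0.
  by move=> *; field; do ?[apply/andP; split].
rewrite frac_xi; have := congr1 (@tofrac ps) J; rewrite tofracB frac_div ?Edunits //.
rewrite !(tofracXn, tofracM) frac_lambert6 frac_dil2_lambert3 -!/(e _).
suff alg (F : fieldType) (e1 e2 e3 e6 q : F) : e1 != 0 -> e2 != 0 -> e3 != 0 -> e6 != 0 ->
    (e2 ^+ 3 * e3 ^+ 2 / (e1 ^+ 2 * e6)) ^+ 2 - q * (e6 ^+ 3 / e2) ^+ 2 =
    e3 ^+ 9 * e2 / (e1 ^+ 3 * e6 ^+ 3) ->
    e2 ^+ 5 * e6 / (e1 * e3 ^+ 5) = 1 + q * e1 ^+ 3 * e6 ^+ 9 / (e2 ^+ 3 * e3 ^+ 9).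
  by apply: alg; apply: e0.
move=> n1 n2 n3 n6 K.
apply/eqP; rewrite -subr_eq0; apply/eqP.
(* The multiplier is 1/[Pi]: after division by [Pi], [K] reads as the claim. *)
transitivity (e1 ^+ 3 * e6 ^+ 3 / (e3 ^+ 9 * e2) *
  ((e2 ^+ 3 * e3 ^+ 2 / (e1 ^+ 2 * e6)) ^+ 2 - q * (e6 ^+ 3 / e2) ^+ 2 -
    e3 ^+ 9 * e2 / (e1 ^+ 3 * e6 ^+ 3))).
  by field; do ?[apply/andP; split].
by rewrite K subrr mulr0.
Qed.

(** The series s is the even part of E_3^3/E_1 divided by the whole, so 1/s = 1 + w with w the ratio
    of odd part to even part. As xi - 1 = w s^3/X, this gives xi - 1 = (1 - s) s^2/X = (1 - s)(2s -
    1). *)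
Lemma xi_s : xi = 3%:R * s - 2%:R * s ^+ 2.
Proof.
have I := congr1 (@tofrac ps) lambert3_dissection.
have S := congr1 (@tofrac ps) s_sqr.
apply: tofrac_inj; rewrite xi_sub1; move: I S.
rewrite !(tofracB, tofracD, tofracMn, tofracXn, tofracM) tofrac1 frac_lambert3.
rewrite frac_dil2_lambert6 frac_dil4_lambert3 frac_s frac_X.
suff alg (F : fieldType) (e1 e2 e3 e4 e6 e12 q : F) : e1 != 0 -> e2 != 0 -> e3 != 0 ->
    e4 != 0 -> e6 != 0 -> e12 != 0 ->
    let s := e1 * e4 ^+ 3 * e6 ^+ 2 / (e2 ^+ 2 * e3 ^+ 3 * e12) in
    let X := e4 ^+ 5 * e12 / (e2 * e6 ^+ 5) in
    e3 ^+ 3 / e1 = e4 ^+ 3 * e6 ^+ 2 / (e2 ^+ 2 * e12) + q * (e12 ^+ 3 / e4) ->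
    s ^+ 2 = X * s *+ 2 - X ->
    1 + q * e1 ^+ 3 * e6 ^+ 9 / (e2 ^+ 3 * e3 ^+ 9) = 3%:R * s - 2%:R * s ^+ 2.
  by apply: alg; apply: e0.
move=> n1 n2 n3 n4 n6 n12 s X I S.
have s0 : s != 0 by rewrite /s !(mulf_neq0, invr_eq0, expf_neq0).
have X0 : X != 0 by rewrite /X !(mulf_neq0, invr_eq0, expf_neq0).
pose w := q * e2 ^+ 2 * e12 ^+ 4 / (e4 ^+ 4 * e6 ^+ 2).
have ws : 1 - s = w * s.
  have -> : w = (e2 ^+ 2 * e12 / (e4 ^+ 3 * e6 ^+ 2)) *
    (e4 ^+ 3 * e6 ^+ 2 / (e2 ^+ 2 * e12) + q * (e12 ^+ 3 / e4)) - 1.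
    by rewrite /w; field; do ?[apply/andP; split].
  by rewrite -I /s; field; do ?[apply/andP; split].
have -> : q * e1 ^+ 3 * e6 ^+ 9 / (e2 ^+ 3 * e3 ^+ 9) = w * s * s ^+ 2 / X.
  by rewrite /w /s /X; field; do ?[apply/andP; split].
rewrite -ws S; move: s0 X0 S; clearbody s X => s0 X0 S.
transitivity (1 + (1 - s) * (s *+ 2 - 1)); first by field.
(* Rewriting with [S] also changed the square on the right-hand side; it is restored here. *)
have -> : 3%:R * s - 2%:R * (X * s *+ 2 - X) = 3%:R * s - 2%:R * s ^+ 2 by rewrite S.
by ring.
Qed.

(** * The generating function of PDO *)

Definition pdo : ps := fun n => (PDO n)%:Z.

(** Number of ways for the part i to occur m times: m choices of the designated copy if i is odd,
    none if i is even, and one way to be absent. *)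
Definition des_coef (i m : nat) : int :=
  if (0 < m)%N then (if odd i then m%:Z else 0) else 1.

Lemma psE_int_mul (c : int) (f : ps) n : (c%:~R * f) n = c * f n.
Proof.
rewrite mulrzl mulrC -mulrzz; case: c => k; first exact: psEMn.
by rewrite NegzE !mulrNz psEN; congr (- _); exact: psEMn.
Qed.

(** Expanding the product of sums gives a sum over multiplicity functions with the same bounds as in
    [PDO]. The index 0 is even, so its factor is 1. *)
Lemma pdo_coef n :
  pdo n = (\prod_(i < n.+1) \sum_(m < n.+1) (des_coef i m)%:~R * q ^+ (i * m)) n.
Proof.
rewrite bigA_distr_bigA psE_sum /pdo /PDO -[LHS]natz natr_sum /= big_mkcond /=.
apply: eq_bigr => m _.
rewrite big_split /= -rmorph_prod prodrXr /= psE_int_mul qXE eq_sym.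
case: eqP => _ /=; last by rewrite mulr0.
rewrite mulr1; case: forallP => [odd_m|].
  rewrite natr_prod big_mkcond; apply: eq_bigr => i _ /=; rewrite /des_coef.
  by case: ifP => // mi; rewrite (implyP (odd_m i) mi) natz.
move/forallP; rewrite negb_forall => /existsP[i]; rewrite negb_imply => /andP[mi /negPf oi].
by rewrite (bigD1 i) //= /des_coef mi oi mul0r.
Qed.

(** With x = q^i, an odd part contributes 1 + x/(1 - x)^2 = (1 - x + x^2)/(1 - x)^2 = (1 - x^6)/((1
    - x^3)(1 - x^2)(1 - x)). *)
Definition des_num (i : nat) : ps := if odd i then 1 - q ^+ (6 * i) else 1.
Definition des_den (i : nat) : ps :=
  if odd i then (1 - q ^+ (3 * i)) * (1 - q ^+ (2 * i)) * (1 - q ^+ i) else 1.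

Lemma sum_des_coef i n : odd i ->
  (\sum_(m < n.+1) (des_coef i m)%:~R * q ^+ (i * m)) * (1 - q ^+ i) ^+ 2 =
  1 - q ^+ i + q ^+ i ^+ 2 - (n.+1)%:R * q ^+ (i * n.+1) + n%:R * q ^+ (i * n.+1) * q ^+ i.
Proof.
move=> oi; elim: n => [|n IH].
  by rewrite big_ord1 /des_coef /= muln0 expr0 muln1; ring.
rewrite big_ord_recr /= mulrDl IH /des_coef /= oi -pmulrn -!exprM ![(i * _.+1)%N]mulnS !exprD.
by rewrite -!natr1; ring.
Qed.

Lemma des_factor i n : eqm n.+1
  ((\sum_(m < n.+1) (des_coef i m)%:~R * q ^+ (i * m)) * des_den i) (des_num i).
Proof.
rewrite /des_den /des_num; case: ifP => oi; last first.
  rewrite mulr1 big_ord_recl /des_coef /= oi muln0 expr0 mulr1 big1 ?addr0 //.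
  by move=> m _; rewrite /= mul0r.
have i0 := odd_gt0 oi; set S := \sum_(m < _) _.
have -> : S * ((1 - q ^+ (3 * i)) * (1 - q ^+ (2 * i)) * (1 - q ^+ i)) =
    (S * (1 - q ^+ i) ^+ 2) * ((1 - q ^+ (3 * i)) * (1 + q ^+ i)).
  by rewrite ![(_ * i)%N]mulnC !exprM; ring.
have -> : 1 - q ^+ (6 * i) =
    (1 - q ^+ i + q ^+ i ^+ 2) * ((1 - q ^+ (3 * i)) * (1 + q ^+ i)).
  by rewrite ![(_ * i)%N]mulnC !exprM; ring.
apply: eqmM => //; rewrite sum_des_coef //.
(* Both truncation errors in [sum_des_coef] are multiples of q^(i(n+1)) with i >= 1. *)
have low f : eqm n.+1 (f * q ^+ (i * n.+1)) 0.
  by rewrite mulrC; apply: qXM_eqm0; rewrite leq_pmull.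
rewrite -[X in eqm _ _ X]addr0; apply: eqmD; last by rewrite mulrAC; apply: low.
by rewrite -[X in eqm _ _ X]subr0; apply: eqmD => //; apply: eqmN; apply: low.
Qed.

Lemma one_subq0 n : (0 < n)%N -> (1 - q ^+ n) 0%N = 1.
Proof. by move=> n0; rewrite psEB psE1 qXE eqxx ltn_eqF // subr0. Qed.

Lemma des_den0 i : des_den i 0%N = 1.
Proof.
rewrite /des_den; case: ifP => // /odd_gt0 i0.
by rewrite !psEM0 !one_subq0 ?muln_gt0.
Qed.

Lemma near1_des_num : near1 (fun m => des_num m.+1).
Proof.
move=> m; rewrite /des_num; case: ifP => // _; rewrite -[q ^+ _]mulr1.
by apply: (@near1_sub (fun m => 6 * m.+1)%N (fun=> 1)) => {}m; lia.
Qed.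

Lemma near1_oddq a : (0 < a)%N -> near1 (fun m => if odd m.+1 then 1 - q ^+ (a * m.+1) else 1).
Proof.
move=> a0 m; case: ifP => // _; rewrite -[q ^+ _]mulr1.
by apply: (@near1_sub (fun m => a * m.+1)%N (fun=> 1)) => {}m; nia.
Qed.

Lemma prodinf_oddq a : (0 < a)%N ->
  prodinf (fun m => if odd m.+1 then 1 - q ^+ (a * m.+1) else 1) = poch a (2 * a).
Proof.
move=> a0; rewrite (@prodinf_block _ 2) ?near1_oddq //; last exact: near1_oddq.
rewrite !big_ord_recl big_ord0 mulr1 /= /bump /=.
rewrite [X in _ * X](_ : _ = 1) ?mulr1.
  rewrite /poch; congr prodinf; apply: funext => m.
  by rewrite addn0 oddM andbF /=; congr (1 - q ^+ _); lia.
apply/esym/prodinf_uniq => [m|N]; first by rewrite addn1 /= oddM andbF.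
by exists N => //; rewrite big1 // => m _; rewrite addn1 /= oddM andbF.
Qed.

Lemma near1_des_den : near1 (fun m => des_den m.+1).
Proof.
move=> m; have := near1_oddq (isT : (0 < 1)%N) (m := m).
have := near1_oddq (isT : (0 < 2)%N) (m := m).
have := near1_oddq (isT : (0 < 3)%N) (m := m).
rewrite /des_den; case: ifP => // _ e3 e2 e1.
rewrite mul1n in e1; have : eqm m.+1 ((1 - q ^+ (3 * m.+1)) * (1 - q ^+ (2 * m.+1)) *
    (1 - q ^+ m.+1)) (1 * 1 * 1) by do ?apply: eqmM.
by rewrite !mulr1.
Qed.

Lemma pdo_prod : pdo * (poch 3 6 * poch 2 4 * poch 1 2) = poch 6 12.
Proof.
have n1 a : (0 < a)%N -> near1 (fun m => if odd m.+1 then 1 - q ^+ (a * m.+1) else 1).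
  exact: near1_oddq.
have -> : poch 6 12 = prodinf (fun m => des_num m.+1) by rewrite -prodinf_oddq.
have -> : poch 3 6 * poch 2 4 * poch 1 2 = prodinf (fun m => des_den m.+1).
  rewrite -(@prodinf_oddq 3) // -(@prodinf_oddq 2) // -(@prodinf_oddq 1) //.
  rewrite !prodinfM //; try exact: n1.
    by congr prodinf; apply: funext => m; rewrite /des_den mul1n; case: ifP; rewrite ?mulr1.
  by move=> m; rewrite -[X in eqm _ _ X]mulr1; apply: eqmM; apply: n1.
pose W i := des_num i / des_den i.
have W1 : near1 (fun m => W m.+1).
  move=> m; rewrite -[X in eqm _ _ X]mulr1 -[X in eqm _ _ (_ * X)]invr1.
  apply: eqmM; first exact: near1_des_num.
  by apply: eqmV; [exact: des_den0|exact: psE1|exact: near1_des_den].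
have -> : pdo = prodinf (fun m => W m.+1).
  apply: funext => n; rewrite pdo_coef /prodinf (prod_stable W1 (leqnSn n)) //.
  transitivity ((\prod_(i < n.+1) W i) n).
    apply: (eqm_prod (N := n.+1)) => // i _.
    apply: (@eqm_cancel _ (des_den i)); first exact: des_den0.
    by rewrite mulrC [X in eqm _ _ X]mulrC divrK ?ps_unit ?des_den0 //; apply: des_factor.
  (* The factor of index 0 is 1, so the infinite product may start at index 1. *)
  by rewrite big_ord_recl {1}/W /des_num /des_den /= divr1 mul1r.
rewrite prodinfM //; last exact: near1_des_den.
congr prodinf; apply: funext => m; rewrite /W divrK //.
by apply: ps_unit; apply: des_den0.
Qed.

Lemma pdoE : pdo = Ed 4 * Ed 6 ^+ 2 / (Ed 1 * Ed 3 * Ed 12).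
Proof.
have O a : (0 < a)%N -> poch a (2 * a) = Ed a / Ed (2 * a).
  case: a => // a _; rewrite -[LHS](mulrK (Ed_unit (2 * a.+1))); congr (_ / _).
  have := congr1 (ps_dil a.+1) E_odd; rewrite rmorphM /= dil_dil // dil_poch //.
  by rewrite muln1 mulnC -!/(Ed _).
have := pdo_prod; rewrite (O 3%N) // (O 2%N) // (O 1%N) // (O 6%N) //.
move=> /(congr1 (@tofrac ps)); rewrite !tofracM !rmorphV ?Ed_unit //= -!/(e _) => h.
apply: tofrac_inj; rewrite frac_div ?Edunits // !(tofracXn, tofracM) -!/(e _); move: h.
suff alg (F : fieldType) (p e1 e2 e3 e4 e6 e12 : F) : e1 != 0 -> e2 != 0 -> e3 != 0 ->
    e4 != 0 -> e6 != 0 -> e12 != 0 ->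
    p * (e3 / e6 * (e2 / e4) * (e1 / e2)) = e6 / e12 -> p = e4 * e6 ^+ 2 / (e1 * e3 * e12).
  by apply: alg; apply: e0.
move=> n1 n2 n3 n4 n6 n12 h.
have -> : p = p * (e3 / e6 * (e2 / e4) * (e1 / e2)) * (e6 * e4 / (e3 * e1)).
  by field; do ?[apply/andP; split].
by rewrite h; field; do ?[apply/andP; split].
Qed.

(** * The 2-dissection of 1 / (E(q) E(q^3)) *)

Lemma sgn_s : sgn s = r. Proof. exact: sgnK. Qed.
(** Since xi = s (3 - 2s), the factor 3 - 2s is xi/s. *)
Lemma frac_3m2s :
  tofrac (3%:R - 2%:R * s) = e 2 ^+ 7 * e 12 / (e 1 ^+ 2 * e 3 ^+ 2 * e 4 ^+ 3 * e 6).
Proof.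
have sn0 : tofrac s != 0 by apply: frac_neq0; rewrite s0.
apply: (mulIf sn0); rewrite -tofracM.
have -> : (3%:R - 2%:R * s) * s = xi by rewrite [RHS]xi_s; ring.
rewrite frac_xi frac_s.
suff alg (F : fieldType) (e1 e2 e3 e4 e6 e12 : F) : e1 != 0 -> e2 != 0 -> e3 != 0 ->
    e4 != 0 -> e6 != 0 -> e12 != 0 ->
    e2 ^+ 5 * e6 / (e1 * e3 ^+ 5) =
    e2 ^+ 7 * e12 / (e1 ^+ 2 * e3 ^+ 2 * e4 ^+ 3 * e6) *
      (e1 * e4 ^+ 3 * e6 ^+ 2 / (e2 ^+ 2 * e3 ^+ 3 * e12)).
  by apply: alg; apply: e0.
by move=> *; field; do ?[apply/andP; split].
Qed.

Definition V : ps := (Ed 1 * Ed 3)^-1.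
(** Chosen so that c0(q^2) is the quotient of V^2 by 3 - 2s. *)
Definition c0 : ps := Ed 2 ^+ 3 * Ed 3 / (Ed 1 ^+ 7 * Ed 6).

Lemma dil2_c0 : ps_dil 2 c0 = Ed 4 ^+ 3 * Ed 6 / (Ed 2 ^+ 7 * Ed 12).
Proof. by rewrite /c0 rmorph_div ?Edunits //= !(rmorphXn, rmorphM) /= !dil_Ed. Qed.

Lemma frac_V : tofrac V = (e 1 * e 3)^-1.
Proof. by rewrite /V rmorphV ?Edunits //= tofracM. Qed.

Lemma V_sqr : V ^+ 2 = (3%:R - 2%:R * s) * ps_dil 2 c0.
Proof.
apply: tofrac_inj; rewrite tofracXn frac_V [in RHS]tofracM frac_3m2s dil2_c0.
rewrite frac_div ?Edunits // !(tofracXn, tofracM) -!/(e _).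
suff alg (F : fieldType) (e1 e2 e3 e4 e6 e12 : F) : e1 != 0 -> e2 != 0 -> e3 != 0 ->
    e4 != 0 -> e6 != 0 -> e12 != 0 ->
    (e1 * e3)^-1 ^+ 2 = e2 ^+ 7 * e12 / (e1 ^+ 2 * e3 ^+ 2 * e4 ^+ 3 * e6) *
      (e4 ^+ 3 * e6 / (e2 ^+ 7 * e12)).
  by apply: alg; apply: e0.
by move=> *; field; do ?[apply/andP; split].
Qed.

Lemma V_sgnV : V * sgn V = Ed 4 * Ed 12 / (Ed 2 ^+ 3 * Ed 6 ^+ 3).
Proof.
apply: tofrac_inj; rewrite [in LHS]tofracM frac_div ?Edunits // !(tofracXn, tofracM) -!/(e _).
rewrite frac_V.
have -> : tofrac (sgn V) = (es 1 * es 3)^-1.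
  rewrite /V rmorphV ?Edunits //= rmorphV ?rmorph_unit ?Edunits //=.
  by rewrite (rmorphM sgn) tofracM.
rewrite !es_odd //.
suff alg (F : fieldType) (e1 e2 e3 e4 e6 e12 : F) : e1 != 0 -> e2 != 0 -> e3 != 0 ->
    e4 != 0 -> e6 != 0 -> e12 != 0 ->
    (e1 * e3)^-1 * (e2 ^+ 3 / (e1 * e4) * (e6 ^+ 3 / (e3 * e12)))^-1 =
    e4 * e12 / (e2 ^+ 3 * e6 ^+ 3).
  by apply: alg; apply: e0.
by move=> *; field; do ?[apply/andP; split].
Qed.

Definition W : ps := Ed 1 ^+ 4 * Ed 6 ^+ 2 / (Ed 2 ^+ 2 * Ed 3 ^+ 4).

Lemma frac_W : tofrac W = e 1 ^+ 4 * e 6 ^+ 2 / (e 2 ^+ 2 * e 3 ^+ 4).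
Proof. by rewrite /W frac_div ?Edunits // !(tofracXn, tofracM). Qed.

(** Both sides have constant term 1 and square 9 - 8 xi. For W, replace q by q^2: 9 - 8X = (3 -
    2s)(3 - 2r), since r + s = 2X and r s = X, and this product is (V(q) V(-q))^2 / c0(q^2)^2. *)
Lemma W_s : W = 4%:R * s - 3%:R.
Proof.
apply: ps_sqr_inj.
  by rewrite psED psEB psEM0 s0 !psEnat /W psEM0 psEV0 !Ed_const.
have -> : (4%:R * s - 3%:R) ^+ 2 = 9%:R - 8%:R * xi by rewrite xi_s; ring.
apply: (@dil_inj 2) => //.
have -> : ps_dil 2 (9%:R - 8%:R * xi) = 9%:R - 8%:R * X.
  by rewrite rmorphB rmorphM /= !rmorph_nat.
have -> : 9%:R - 8%:R * X = (3%:R - 2%:R * s) * sgn (3%:R - 2%:R * s).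
  rewrite rmorphB rmorphM /= !rmorph_nat sgn_s.
  have -> : (3%:R - 2%:R * s) * (3%:R - 2%:R * r) = 9%:R - 6%:R * (r + s) + 4%:R * (r * s).
    by ring.
  by rewrite r_plus_s rs; ring.
have u : ps_dil 2 c0 ^+ 2 \is a GRing.unit by rewrite unitrX // dil2_c0 !Edunits.
apply: (mulIr u).
have -> : (3%:R - 2%:R * s) * sgn (3%:R - 2%:R * s) * ps_dil 2 c0 ^+ 2 = (V * sgn V) ^+ 2.
  have -> : (V * sgn V) ^+ 2 = V ^+ 2 * sgn (V ^+ 2) by rewrite (rmorphXn sgn) exprMn.
  rewrite V_sqr (rmorphM sgn) /= [sgn (ps_dil 2 c0)]sgn_dil_even //.
  by ring.
rewrite V_sgnV dil2_c0 /W rmorphXn rmorph_div ?Edunits //= !(rmorphXn, rmorphM) /= !dil_Ed.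
apply: tofrac_inj; rewrite [in LHS]tofracM !tofracXn !frac_div ?Edunits //.
rewrite !(tofracXn, tofracM) -!/(e _).
suff alg (F : fieldType) (e2 e4 e6 e12 : F) : e2 != 0 -> e4 != 0 -> e6 != 0 -> e12 != 0 ->
    (e2 ^+ 4 * e12 ^+ 2 / (e4 ^+ 2 * e6 ^+ 4)) ^+ 2 * (e4 ^+ 3 * e6 / (e2 ^+ 7 * e12)) ^+ 2 =
    (e4 * e12 / (e2 ^+ 3 * e6 ^+ 3)) ^+ 2.
  by apply: alg; apply: e0.
by move=> *; field; do ?[apply/andP; split].
Qed.

Definition A : ps := Ed 4 ^+ 2 * Ed 6 ^+ 5 / (Ed 1 ^+ 2 * Ed 2 * Ed 3 ^+ 4 * Ed 12 ^+ 2).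

Lemma frac_A : tofrac A =
  e 4 ^+ 2 * e 6 ^+ 5 / (e 1 ^+ 2 * e 2 * e 3 ^+ 4 * e 12 ^+ 2).
Proof. by rewrite /A frac_div ?Edunits // !(tofracXn, tofracM). Qed.

Lemma frac_c0 : tofrac c0 = e 2 ^+ 3 * e 3 / (e 1 ^+ 7 * e 6).
Proof. by rewrite /c0 frac_div ?Edunits // !(tofracXn, tofracM). Qed.

(** The right side is c0 (6 - 4 xi + 2W), which [W_s] and [xi_s] turn into 4 c0 s (2s - 1); then 2s
    - 1 = s^2/X makes it a product, whose square root is read off the exponents. *)
Lemma A_sqr : 4%:R * A ^+ 2 =
  c0 * (6%:R - 4%:R * xi) + 2%:R * (Ed 2 * Ed 6 / (Ed 1 ^+ 3 * Ed 3 ^+ 3)).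
Proof.
have X0 : tofrac X != 0 by apply: frac_neq0; rewrite /X dilE0 xi0.
have sX : tofrac (2%:R * s - 1) = tofrac s ^+ 2 / tofrac X.
  apply: (canRL (mulfK X0)); rewrite -tofracXn -tofracM s_sqr; congr tofrac; ring.
have -> : Ed 2 * Ed 6 / (Ed 1 ^+ 3 * Ed 3 ^+ 3) = c0 * W.
  apply: tofrac_inj; rewrite [in RHS]tofracM frac_W !frac_div ?Edunits //.
  rewrite !(tofracXn, tofracM) -!/(e _).
  suff alg (F : fieldType) (e1 e2 e3 e6 : F) : e1 != 0 -> e2 != 0 -> e3 != 0 -> e6 != 0 ->
      e2 * e6 / (e1 ^+ 3 * e3 ^+ 3) =
      e2 ^+ 3 * e3 / (e1 ^+ 7 * e6) * (e1 ^+ 4 * e6 ^+ 2 / (e2 ^+ 2 * e3 ^+ 4)).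
    by apply: alg; apply: e0.
  by move=> *; field; do ?[apply/andP; split].
have -> : c0 * (6%:R - 4%:R * xi) + 2%:R * (c0 * W) = 4%:R * (c0 * s * (2%:R * s - 1)).
  by rewrite W_s xi_s; ring.
congr (_ * _); apply: tofrac_inj.
rewrite tofracXn frac_A (tofracM (c0 * s)) (tofracM c0) sX frac_s frac_X frac_c0.
suff alg (F : fieldType) (e1 e2 e3 e4 e6 e12 : F) : e1 != 0 -> e2 != 0 -> e3 != 0 ->
    e4 != 0 -> e6 != 0 -> e12 != 0 ->
    (e4 ^+ 2 * e6 ^+ 5 / (e1 ^+ 2 * e2 * e3 ^+ 4 * e12 ^+ 2)) ^+ 2 =
    e2 ^+ 3 * e3 / (e1 ^+ 7 * e6) *
    (e1 * e4 ^+ 3 * e6 ^+ 2 / (e2 ^+ 2 * e3 ^+ 3 * e12)) *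
    ((e1 * e4 ^+ 3 * e6 ^+ 2 / (e2 ^+ 2 * e3 ^+ 3 * e12)) ^+ 2 /
     (e4 ^+ 5 * e12 / (e2 * e6 ^+ 5))).
  by apply: alg; apply: e0.
by move=> *; field; do ?[apply/andP; split].
Qed.

(** The square of V(q) + V(-q) is c0(q^2) (6 - 2(r + s)) + 2 V(q) V(-q). With r + s = 2X this is 4
    A(q^2)^2, and constant terms fix the sign. *)
Lemma U_V : U V = A.
Proof.
apply: U_even; have V0 : V 0%N = 1 by rewrite /V psEV0 // !Ed_const.
apply: ps_sqr_inj.
  by rewrite !psED sgnE0 V0 psEMn dilE0 /A psEM0 psEV0 !Ed_const.
have -> : (V + sgn V) ^+ 2 = V ^+ 2 + sgn (V ^+ 2) + 2%:R * (V * sgn V).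
  by rewrite (rmorphXn sgn) /=; ring.
rewrite V_sqr (rmorphM sgn) /= [sgn (ps_dil 2 c0)]sgn_dil_even // V_sgnV.
have -> : sgn (3%:R - 2%:R * s) = 3%:R - 2%:R * r.
  by rewrite rmorphB rmorphM /= !rmorph_nat sgn_s.
have -> : (3%:R - 2%:R * s) * ps_dil 2 c0 + (3%:R - 2%:R * r) * ps_dil 2 c0 =
   ps_dil 2 c0 * (6%:R - 2%:R * (r + s)) by ring.
rewrite r_plus_s.
have -> : (ps_dil 2 A *+ 2) ^+ 2 = ps_dil 2 (4%:R * A ^+ 2).
  by rewrite (rmorphM _ (4%:R) (A ^+ 2)) (rmorphXn _ 2 A) /= rmorph_nat; ring.
rewrite A_sqr; set Y := Ed 2 * Ed 6 / _.
have -> : Ed 4 * Ed 12 / (Ed 2 ^+ 3 * Ed 6 ^+ 3) = ps_dil 2 Y.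
  by rewrite /Y rmorph_div ?Edunits //= !(rmorphXn, rmorphM) /= !dil_Ed.
rewrite (rmorphD _ (c0 * _)) (rmorphM _ c0) (rmorphM _ (2%:R) Y) /=.
by rewrite (rmorphB _ (6%:R)) (rmorphM _ (4%:R) xi) /= !rmorph_nat -/X; ring.
Qed.

(** * Two applications of U to the generating function of PDO *)

Lemma U_pdo : U pdo = Ed 4 ^+ 2 * Ed 6 ^+ 4 / (Ed 1 ^+ 2 * Ed 3 ^+ 2 * Ed 12 ^+ 2).
Proof.
have -> : pdo = V * ps_dil 2 (Ed 2 * Ed 3 ^+ 2 / Ed 6).
  rewrite pdoE rmorph_div ?Edunits //= !(rmorphXn, rmorphM) /= !dil_Ed /V.
  apply: tofrac_inj; rewrite [in RHS]tofracM rmorphV ?Edunits //= !frac_div ?Edunits //.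
  rewrite !(tofracXn, tofracM) -!/(e _).
  suff alg (F : fieldType) (e1 e3 e4 e6 e12 : F) : e1 != 0 -> e3 != 0 -> e12 != 0 ->
      e4 * e6 ^+ 2 / (e1 * e3 * e12) = (e1 * e3)^-1 * (e4 * e6 ^+ 2 / e12).
    by apply: alg; apply: e0.
  by move=> *; field; do ?[apply/andP; split].
rewrite UM_dil U_V /A; apply: tofrac_inj; rewrite [in LHS]tofracM !frac_div ?Edunits //.
rewrite !(tofracXn, tofracM) -!/(e _).
suff alg (F : fieldType) (e1 e2 e3 e4 e6 e12 : F) : e1 != 0 -> e2 != 0 -> e3 != 0 ->
    e6 != 0 -> e12 != 0 ->
    e4 ^+ 2 * e6 ^+ 5 / (e1 ^+ 2 * e2 * e3 ^+ 4 * e12 ^+ 2) * (e2 * e3 ^+ 2 / e6) =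
    e4 ^+ 2 * e6 ^+ 4 / (e1 ^+ 2 * e3 ^+ 2 * e12 ^+ 2).
  by apply: alg; apply: e0.
by move=> *; field; do ?[apply/andP; split].
Qed.

Lemma dil2_gamma : ps_dil 2 gamma = Ed 2 ^+ 5 * Ed 4 ^+ 5 * Ed 12 ^+ 5 / Ed 6 ^+ 15.
Proof. by rewrite gammaE rmorph_div ?Edunits //= !(rmorphXn, rmorphM) /= !dil_Ed. Qed.

Lemma frac_gamma : tofrac gamma = e 1 ^+ 5 * e 2 ^+ 5 * e 6 ^+ 5 / e 3 ^+ 15.
Proof. by rewrite gammaE frac_div ?Edunits // !(tofracXn, tofracM). Qed.

Lemma frac_dil2_gamma :
  tofrac (ps_dil 2 gamma) = e 2 ^+ 5 * e 4 ^+ 5 * e 12 ^+ 5 / e 6 ^+ 15.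
Proof. by rewrite dil2_gamma frac_div ?Edunits // !(tofracXn, tofracM). Qed.

Lemma gamma_unit : gamma \is a GRing.unit.
Proof. exact/ps_unit/gamma0. Qed.

Lemma U_s : U s = xi.
Proof.
by rewrite -U_r; apply: funext => n; rewrite /U /s /sgn -signr_odd oddM mul1r.
Qed.

Lemma gamma_UU_pdo : gamma * U (U pdo) = 3%:R * xi ^+ 2 - 2%:R * xi ^+ 3.
Proof.
rewrite mulrC -UM_dil.
have -> : U pdo * ps_dil 2 gamma = (3%:R - 2%:R * s) * ps_dil 2 (xi ^+ 2).
  rewrite (rmorphXn _ 2 xi) -/X U_pdo dil2_gamma; apply: tofrac_inj.
  rewrite [in RHS]tofracM frac_3m2s [in LHS]tofracM tofracXn frac_X !frac_div ?Edunits //.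
  rewrite !(tofracXn, tofracM) -!/(e _).
  suff alg (F : fieldType) (e1 e2 e3 e4 e6 e12 : F) : e1 != 0 -> e2 != 0 -> e3 != 0 ->
      e4 != 0 -> e6 != 0 -> e12 != 0 ->
      e4 ^+ 2 * e6 ^+ 4 / (e1 ^+ 2 * e3 ^+ 2 * e12 ^+ 2) *
      (e2 ^+ 5 * e4 ^+ 5 * e12 ^+ 5 / e6 ^+ 15) =
      e2 ^+ 7 * e12 / (e1 ^+ 2 * e3 ^+ 2 * e4 ^+ 3 * e6) *
      (e4 ^+ 5 * e12 / (e2 * e6 ^+ 5)) ^+ 2.
    by apply: alg; apply: e0.
  by move=> *; field; do ?[apply/andP; split].
rewrite UM_dil (_ : U (3%:R - 2%:R * s) = 3%:R - 2%:R * xi); first by ring.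
have -> : 3%:R - 2%:R * s = ps_dil 2 (3%:R) - s *+ 2 by rewrite rmorph_nat mulr_natl.
by rewrite (raddfB U) (raddfMn U) /= U_dil U_s mulr_natl.
Qed.

(** * The operator U on polynomials in xi(q^2) and s *)

(** The value of [ps_peval], in the Horner form to which the morphism lemmas for polynomials
    apply. *)
Definition polyval (P : {poly int}) (x : ps) : ps := (map_poly intr P).[x].

Lemma polyvalD P R x : polyval (P + R) x = polyval P x + polyval R x.
Proof. by rewrite /polyval rmorphD hornerD. Qed.
Lemma polyvalM P R x : polyval (P * R) x = polyval P x * polyval R x.
Proof. by rewrite /polyval rmorphM hornerM. Qed.
Lemma polyvalN P x : polyval (- P) x = - polyval P x.
Proof. by rewrite /polyval rmorphN hornerN. Qed.
Lemma polyvalX x : polyval 'X x = x.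
Proof. by rewrite /polyval map_polyX hornerX. Qed.
Lemma polyvalC c x : polyval c%:P x = c%:~R.
Proof. by rewrite /polyval map_polyC hornerC. Qed.

Lemma ps_pevalE P x : ps_peval P x = polyval P x.
Proof.
apply: funext => n; rewrite /ps_peval /polyval.
rewrite (horner_coef_wide _ (size_poly _ _)) psE_sum; apply: eq_bigr => i _.
by rewrite coef_map /= psE_int_mul ps_powE.
Qed.

Lemma dil_polyval a P x : ps_dil a.+1 (polyval P x) = polyval P (ps_dil a.+1 x).
Proof.
rewrite /polyval -horner_map -map_poly_comp; congr (_.[_]).
by apply: eq_map_poly => c /=; rewrite rmorph_int.
Qed.

Definition Xs_span (f : ps) := exists P R, f = polyval P X + polyval R X * s.

Lemma Xs_spanM f g : Xs_span f -> Xs_span g -> Xs_span (f * g).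
Proof.
move=> [P [R ->]] [P' [R' ->]].
(* The product is reduced by s^2 = 2Xs - X. *)
exists (P * P' - R * R' * 'X), (P * R' + R * P' + 2%:P * R * R' * 'X).
rewrite !(polyvalD, polyvalM, polyvalN, polyvalX, polyvalC).
transitivity (polyval P X * polyval P' X +
   (polyval P X * polyval R' X + polyval R X * polyval P' X) * s +
   polyval R X * polyval R' X * s ^+ 2); first by ring.
by rewrite s_sqr; ring.
Qed.

Lemma Xs_span1 : Xs_span 1.
Proof.
by exists 1%:P, 0%:P; rewrite !polyvalC mul0r addr0.
Qed.

Lemma Xs_spanX f k : Xs_span f -> Xs_span (f ^+ k).
Proof.
move=> Sf; elim: k => [|k IH]; first exact: Xs_span1.
by rewrite exprS; apply: Xs_spanM.
Qed.

Lemma Xs_span_r : Xs_span r.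
Proof.
exists (2%:P * 'X), (-1)%:P; rewrite !(polyvalM, polyvalC, polyvalX).
have -> : r = X *+ 2 - s by rewrite -r_plus_s addrK.
by ring.
Qed.

Lemma Xs_span_xi : Xs_span xi.
Proof.
exists (2%:P * 'X), (3%:P - 4%:P * 'X).
rewrite !(polyvalD, polyvalM, polyvalN, polyvalC, polyvalX) xi_s s_sqr; ring.
Qed.

(** Polynomials in X = xi(q^2) leave [U] as polynomials in xi, and [U] s = xi; so P(X) + R(X) s goes
    to P(xi) + xi R(xi). *)
Lemma U_Xs_span f : Xs_span f -> exists P, U f = polyval P xi.
Proof.
move=> [P [R ->]]; exists (P + R * 'X).
rewrite raddfD /= mulrC /X -!dil_polyval U_dil UM_dil U_s.
by rewrite polyvalD polyvalM polyvalX; ring.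
Qed.

Lemma kappa_r : kappa = r ^+ 5.
Proof.
apply: tofrac_inj; rewrite kappaE frac_div ?gamma_unit // frac_gamma.
rewrite !tofracXn frac_dil2_gamma frac_r.
suff alg (F : fieldType) (e1 e2 e3 e4 e6 e12 : F) : e1 != 0 -> e2 != 0 -> e3 != 0 ->
    e4 != 0 -> e6 != 0 -> e12 != 0 ->
    (e2 ^+ 5 * e4 ^+ 5 * e12 ^+ 5 / e6 ^+ 15) ^+ 2 /
    (e1 ^+ 5 * e2 ^+ 5 * e6 ^+ 5 / e3 ^+ 15) =
    (e2 * e4 ^+ 2 * e12 ^+ 2 * e3 ^+ 3 / (e1 * e6 ^+ 7)) ^+ 5.
  by apply: alg; apply: e0.
by move=> *; field; do ?[apply/andP; split].
Qed.

Lemma zetaE i j : zeta i j = U (kappa ^+ i * xi ^+ j).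
Proof. by rewrite /zeta !ps_powE. Qed.

Lemma zeta_poly i j : exists P, zeta i j = polyval P xi.
Proof.
rewrite zetaE kappa_r; apply/U_Xs_span/Xs_spanM; apply: Xs_spanX.
  exact/Xs_spanX/Xs_span_r.
exact: Xs_span_xi.
Qed.

(** * The recursion for Lambda *)

Definition PDO_pow2 k : ps := fun n => (PDO (2 ^ k * n))%:Z.

Lemma U_PDO_pow2 k : U (PDO_pow2 k) = PDO_pow2 k.+1.
Proof. by apply: funext => n; rewrite /U /PDO_pow2 mulnA -expnSr. Qed.

Lemma LambdaE k : Lambda k = gamma ^+ (2 ^ (k - 2)) * PDO_pow2 k.
Proof. by rewrite /Lambda ps_powE. Qed.

Lemma Lambda2 : Lambda 2 = 3%:R * xi ^+ 2 - 2%:R * xi ^+ 3.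
Proof.
have -> : Lambda 2 = gamma * PDO_pow2 2 by rewrite LambdaE.
have -> : PDO_pow2 2 = U (U pdo).
  by rewrite -!U_PDO_pow2; congr (U (U _)); apply: funext => n; rewrite /PDO_pow2 mul1n.
exact: gamma_UU_pdo.
Qed.

(** With i = 2^(k-3), the denominator of kappa^i cancels the factor gamma^i of the previous series.
    What remains is gamma(q^2)^(2i), which leaves [U] as gamma^(2i), the power required at level
    k. *)
Lemma Lambda_step k : (3 <= k)%N -> Lambda k = U (kappa ^+ (2 ^ (k - 3)) * Lambda (k - 1)).
Proof.
case: k => [|[|[|k]]] // _.
have -> : (k.+3 - 3 = k)%N by rewrite subSS subn2 /=; lia.
have -> : (k.+3 - 1 = k.+2)%N by rewrite subn1.
rewrite !LambdaE kappaE subSS subn1 subn2 /= -U_PDO_pow2.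
have -> : (ps_dil 2 gamma ^+ 2 / gamma) ^+ (2 ^ k) * (gamma ^+ (2 ^ k) * PDO_pow2 k.+2) =
    PDO_pow2 k.+2 * ps_dil 2 (gamma ^+ (2 ^ k.+1)).
  by rewrite mulrA -exprMn divrK ?gamma_unit // (rmorphXn (ps_dil 2)) expnS exprM mulrC.
by rewrite UM_dil mulrC.
Qed.

Lemma Lambda_rec k P : (3 <= k)%N -> Lambda (k - 1) = ps_peval P xi ->
  Lambda k = \sum_(l < size P) (P`_l)%:~R * zeta (2 ^ (k - 3)) l.
Proof.
move=> k3 LP; rewrite Lambda_step // LP ps_pevalE /polyval.
rewrite (horner_coef_wide _ (size_poly _ _)) mulr_sumr raddf_sum; apply: eq_bigr => l _ /=.
by rewrite coef_map zetaE /= mulrCA !mulrzl raddfMz.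
Qed.

Theorem theorem2p7 :
  (forall k : nat, (2 <= k)%N -> exists P : {poly int}, Lambda k = ps_peval P xi)
  /\ Lambda 2 = (fun n => 3 * ps_pow xi 2 n - 2 * ps_pow xi 3 n)
  /\ (forall (k : nat) (P : {poly int}), (3 <= k)%N ->
        Lambda (k - 1) = ps_peval P xi ->
        Lambda k = (fun n => \sum_(l < size P) P`_l * zeta (2 ^ (k - 3)) l n)).
Proof.
split; last split.
- elim=> // k IH; rewrite leq_eqVlt => /orP[/eqP <-|k2].
    exists (3%:P * 'X * 'X - 2%:P * 'X * 'X * 'X); rewrite Lambda2 ps_pevalE.
    by rewrite !(polyvalD, polyvalM, polyvalN, polyvalC, polyvalX); ring.
  have [P LP] := IH k2; have := @Lambda_rec k.+1 P k2; rewrite subn1 => /(_ LP) ->.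
  elim/big_ind: _ => [|f g [A ->] [B ->]|l _].
  + by exists 0; rewrite ps_pevalE /polyval rmorph0 horner0.
  + by exists (A + B); rewrite !ps_pevalE polyvalD.
  + have [R ->] := zeta_poly (2 ^ (k.+1 - 3)) l.
    by exists ((P`_l)%:P * R); rewrite ps_pevalE polyvalM polyvalC.
- rewrite Lambda2; apply: funext => n; rewrite psEB !ps_powE; congr (_ - _).
    exact: (psE_int_mul 3).
  exact: (psE_int_mul 2).
- move=> k P k3 LP; rewrite (Lambda_rec k3 LP); apply: funext => n.
  by rewrite psE_sum; apply: eq_bigr => l _; rewrite psE_int_mul.
Qed.
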